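(* Fix $q\in(0,1)$ and let $\Gamma_n=K_{a_n,b_n}$ be the complete bipartite graph with parts of sizes $1\le a_n\le b_n$, $a_n+b_n\le n$, where $a_n\le a_0$ for some constant $a_0<\infty$. If $Q_n=o\left(\frac{n^3}{b_n^2}\right)$, then weak detection is impossible with query budget $Q_n$. On the other hand, there exist constants $C_1=C_1(q)>0$ and $C=C(q,a_0)>0$ such that, if $m=\left\lceil C_1\frac{n^2}{b_n^2}\log n\right\rceil$ satisfies $m\le n/2$ and $(a_n+b_n)\,m/n\ge10\log n$, then $$Q_n\ge C\frac{n^3}{b_n^2}\log^2n$$ implies that strong detection is possible with query budget $Q_n$.
   Context: Setup. Under $\mathcal H_0$, $G$ is a random graph on $[n]=\{1,\dots,n\}$ in which each pair in $\binom{[n]}{2}$ is an edge independently with probability $q$. Under $\mathcal H_1$, a copy $\Gamma_n^\star$ is drawn uniformly from the set of all subgraphs of the complete graph on $[n]$ isomorphic to $\Gamma_n$; all edges of $\Gamma_n^\star$ are in $G$, and every other pair is an edge independently with probability $q$. For a query set $\mathcal Q\subseteq\binom{[n]}{2}$ (chosen non-adaptively), the transcript is $G_{\mathcal Q}=(\mathbf 1\{e\in e(G)\})_{e\in\mathcal Q}$, with laws $\mathbb P_{\mathcal H_0,\mathcal Q}$, $\mathbb P_{\mathcal H_1,\mathcal Q}$. The optimal risk under budget $Q_n$ is $R^\star_{n,Q_n}=1-\sup_{|\mathcal Q|\le Q_n} d_{\mathrm{TV}}(\mathbb P_{\mathcal H_1,\mathcal Q},\mathbb P_{\mathcal H_0,\mathcal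 Q})$. Weak detection is impossible with budget $Q_n$ if $\lim_nR^\star_{n,Q_n}=1$. Strong detection is possible with budget $Q_n$ if there are (possibly random, independent of $G$) query sets $\mathcal Q_n$ with $|\mathcal Q_n|\le Q_n$ and tests based on $G_{\mathcal Q_n}$ whose sum of type-I and type-II error probabilities tends to $0$. *)

(* Defs.v *)
From HB Require Import structures.
From mathcomp Require Import all_boot all_order all_algebra.
From mathcomp Require Import all_classical all_reals all_analysis.

Set Implicit Arguments.
Unset Strict Implicit.
Unset Printing Implicit Defensive.

Import Order.TTheory GRing.Theory Num.Theory.
Import numFieldNormedType.Exports.

Local Open Scope ring_scope.

Record sgraph := SGraph {
  vertex :> finType;
  adj : rel vertex;
  adj_sym : symmetric adj;
  adj_irrefl : irreflexive adj
}.

Definition Kbip_adj (a b : nat) : rel ('I_a + 'I_b)%type :=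
  fun x y => match x, y with
             | inl _, inr _ | inr _, inl _ => true
             | _, _ => false
             end.

Lemma Kbip_adj_sym a b : symmetric (@Kbip_adj a b).
Proof. by move=> [x|x] [y|y]. Qed.

Lemma Kbip_adj_irrefl a b : irreflexive (@Kbip_adj a b).
Proof. by move=> [x|x]. Qed.

Definition Kbip (a b : nat) : sgraph :=
  SGraph (@Kbip_adj_sym a b) (@Kbip_adj_irrefl a b).

Definition vpair (n : nat) := {e : {set 'I_n} | #|e| == 2%N}.

(* A graph with vertex set exactly [n] is given by its edge set. *)
Definition graph (n : nat) := {set vpair n}.

(* A subgraph of the complete graph on [n] has its own vertex set H.1 and its
   edge set H.2; the witness f is an isomorphism from Gamma onto H. *)
Definition copies (Gamma : sgraph) (n : nat) :
    {set {set 'I_n} * {set vpair n}} :=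
  [set H : {set 'I_n} * {set vpair n} |
    [forall e in H.2, val e \subset H.1] &&
    [exists f : {ffun Gamma -> 'I_n},
      [&& injectiveb f, f @: [set: Gamma] == H.1 &
          [forall x, forall y,
             adj x y == [exists e in H.2, val e == [set f x; f y]]]]]].

Local Open Scope classical_set_scope.

Section Laws.
Variables (R : realType) (q : R).

Definition edge_law (present : bool) : R := if present then q else 1 - q.

Definition law_H0 (n : nat) (G : graph n) : R :=
  \prod_(e : vpair n) edge_law (e \in G).

Definition law_planted (n : nat) (S : {set vpair n}) (G : graph n) : R :=
  \prod_(e : vpair n)
    (if e \in S then (e \in G)%:R else edge_law (e \in G)).

Definition law_H1 (Gamma : sgraph) (n : nat) (G : graph n) : R :=
  (#|copies Gamma n|%:R)^-1 *
  \sum_(H in copies Gamma n) law_planted H.2 G.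

Definition transcript_type (n : nat) (Q : {set vpair n}) :=
  {ffun {e : vpair n | e \in Q} -> bool}.

Definition transcript (n : nat) (Q : {set vpair n}) (G : graph n) :
    transcript_type Q :=
  [ffun e => val e \in G].

Definition transcript_law (n : nat) (P : graph n -> R) (Q : {set vpair n})
    (t : transcript_type Q) : R :=
  \sum_(G : graph n | transcript Q G == t) P G.

Definition dTV (T : finType) (P P' : T -> R) : R :=
  2^-1 * \sum_(t : T) `|P t - P' t|.

Definition optimal_risk (Gamma : sgraph) (n k : nat) : R :=
  1 - sup [set dTV (transcript_law (law_H1 Gamma (n := n)) (Q := Q))
                   (transcript_law (@law_H0 n) (Q := Q))
          | Q in [set Q : {set vpair n} | (#|Q| <= k)%N]].

Definition weak_detection_impossible (Gamma : nat -> sgraph)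
    (Qn : nat -> nat) : Prop :=
  optimal_risk (Gamma n) n (Qn n) @[n --> \oo] --> (1 : R).

Definition is_pmf (T : finType) (p : T -> R) : Prop :=
  (forall x, 0 <= p x) /\ \sum_(x : T) p x = 1.

(* nu is the law of the random query set, drawn independently of the graph;
   the test phi returns true when it decides for H1. *)
Definition error_sum (Gamma : sgraph) (n : nat) (nu : {set vpair n} -> R)
    (phi : forall Q : {set vpair n}, transcript_type Q -> bool) : R :=
  \sum_(Q : {set vpair n}) nu Q *
    (\sum_(t : transcript_type Q | phi Q t) transcript_law (@law_H0 n) t) +
  \sum_(Q : {set vpair n}) nu Q *
    (\sum_(t : transcript_type Q | ~~ phi Q t)
        transcript_law (law_H1 Gamma (n := n)) t).

Definition strong_detection_possible (Gamma : nat -> sgraph)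
    (Qn : nat -> nat) : Prop :=
  exists (nu : forall n, {set vpair n} -> R)
         (phi : forall n (Q : {set vpair n}), transcript_type Q -> bool),
    [/\ forall n, is_pmf (nu n),
        forall n (Q : {set vpair n}), 0 < nu n Q -> (#|Q| <= Qn n)%N
      & error_sum (Gamma n) (nu n) (phi n) @[n --> \oo] --> (0 : R)].

End Laws.

(* Main.v *)
Require Import Defs.
From HB Require Import structures.
From mathcomp Require Import all_boot all_order all_algebra ring lra zify.

(** Impossibility.  Condition on the small part [A]; by convexity the total
    variation distance is at most its average over [A].  Given [A], the
    likelihood ratio has second moment
    E_{B,B'} q^{-|E(A,B) & E(A,B') & Q|}, and since drawing [B] without
    replacement is dominated by independent sampling, this is at most
    exp((b/N)^2 q^{-a0} sum_{u in A} deg_Q u) with N = n - a.  The exponent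
    averages to O(b^2 |Q| / n^3).  Conditioning is essential: the unconditional
    second moment is dominated by the rare coincidence of the two small parts.

    Detection.  Query every pair meeting a fixed set [S] of [m] vertices, and
    look for a vertex with at least (1-q)mb/(4n) more than the expected number
    of neighbours in [S].  Chernoff bounds with a union bound control the
    type-I error; under the alternative [S] contains about mb/n vertices of
    [B], by Chebyshev, and all of them are adjacent to each vertex of [A]. *)

Set Implicit Arguments.
Unset Strict Implicit.
Unset Printing Implicit Defensive.

Import Order.TTheory GRing.Theory Num.Theory.

Local Open Scope ring_scope.

(** * Uniformly random subsets *)

(** Such a [B] is [U] together with an arbitrary subset of [D :\: U] of size [b - #|U|], so the
    count reduces to [cards_draws]. *)
Lemma card_subsets_between (T : finType) (D U : {set T}) (b : nat) :
  U \subset D -> (#|U| <= b)%N ->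
  #|[set B : {set T} | [&& B \subset D, #|B| == b & U \subset B]]| =
  'C(#|D| - #|U|, b - #|U|).
Proof.
move=> UD Ub.
have <- : #|D :\: U| = (#|D| - #|U|)%N.
  by rewrite cardsD; have/setIidPr-> := UD.
rewrite -cards_draws -[RHS](card_in_imset (f := fun B => U :|: B)); last first.
  move=> B B'; rewrite !inE. rewrite !subsetD.
  move=> /andP[/andP[_ dB] _] /andP[/andP[_ dB'] _].
  move=> /(congr1 (fun Z => Z :\: U)); rewrite !setDUl setDv !set0U.
  by move/setDidPl: dB => ->; move/setDidPl: dB' => ->.
apply: eq_card => B; apply/idP/imsetP; rewrite inE.
  move=> /and3P[BD /eqP Bb UB]; exists (B :\: U).
    by rewrite inE setSD // cardsD; have/setIidPr-> := UB; rewrite Bb eqxx.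
  apply/setP=> x; rewrite !inE.
  by case: (boolP (x \in U)) => //= /(subsetP UB) ->.
case=> B'; rewrite inE subsetD => /andP[/andP[B'D dB'] /eqP cB'] ->.
apply/and3P; split; rewrite ?subsetUl ?subUset ?UD //.
by rewrite cardsU setIC disjoint_setI0 // cards0 subn0 cB' subnKC.
Qed.

(** The ratio of the two binomials is the probability that a uniform [b]-subset of [N] points
    contains [u] given ones. It is the product of [(b - i) / (N - i)] over [i < u], and each factor
    is at most [b / N]. *)
Lemma bin_sub_ratio (R : realFieldType) (N b u : nat) :
  (u <= b)%N -> (b <= N)%N ->
  ('C(N - u, b - u))%:R <= 'C(N, b)%:R * (b%:R / N%:R) ^+ u :> R.
Proof.
elim: u => [|u IH] ub bN; first by rewrite !subn0 expr0 mulr1.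
have N0 : 0 < N%:R :> R by rewrite ltr0n; lia.
have Nu : 0 < (N - u)%:R :> R by rewrite ltr0n; lia.
have step : ((b - u) * 'C(N - u, b - u) = (N - u) * 'C(N - u.+1, b - u.+1))%N.
  have -> : (b - u)%N = (b - u.+1).+1 by lia.
  have -> : (N - u)%N = (N - u.+1).+1 by lia.
  by rewrite -mul_bin_diag.
have -> : 'C(N - u.+1, b - u.+1)%:R =
    (b - u)%:R / (N - u)%:R * 'C(N - u, b - u)%:R :> R.
  rewrite mulrAC -natrM step natrM; field; lra.
rewrite exprSr mulrA mulrC ler_pM //.
- by rewrite divr_ge0.
- by apply: IH => //; lia.
rewrite ler_pdivrMr // mulrAC ler_pdivlMr // -!natrM ler_nat.
nia.
Qed.

Lemma prod_add1_expand (R : comPzRingType) (T : finType) (B : {set T})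
    (z : T -> R) :
  \prod_(v in B) (1 + z v) =
  \sum_(U : {set T} | U \subset B) \prod_(v in U) z v.
Proof.
(* Extending [z] by zero outside [B] turns the product into one over the whole type, where
   distributivity applies. *)
pose z' v := if v \in B then z v else 0.
transitivity (\prod_v (z' v + 1)).
  rewrite big_mkcond /=; apply: eq_bigr => v _.
  by rewrite /z'; case: ifP => _; rewrite ?add0r // addrC.
rewrite bigA_distr [RHS]big_mkcond /=; apply: eq_bigr => U _.
rewrite -big_mkcond /=; case: ifP => [UB|/negbT/subsetPn[v vU vB]].
  by apply: eq_bigr => v vU; rewrite /z' (subsetP UB).
by rewrite (bigD1 v) //= /z' (negbTE vB) mul0r.
Qed.

(* The right-hand side is what independent sampling at rate [b / #|D|] gives:
   expanding the product, each [U] of size [u] is contained in a random [B] with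
   probability at most [(b / #|D|) ^+ u]. *)
Lemma sum_subsets_prod_le (R : realFieldType) (T : finType) (D : {set T})
    (b : nat) (w : T -> R) :
  (forall v, 0 <= w v) -> (b <= #|D|)%N ->
  \sum_(B : {set T} | (B \subset D) && (#|B| == b)) \prod_(v in B) (1 + w v) <=
  'C(#|D|, b)%:R * \prod_(v in D) (1 + w v * (b%:R / #|D|%:R)).
Proof.
move=> w0 bD.
under [leLHS]eq_bigr do rewrite prod_add1_expand.
rewrite (exchange_big_dep (fun U : {set T} => U \subset D)) /=; last first.
  by move=> B U /andP[BD _] /subset_trans; apply.
rewrite prod_add1_expand mulr_sumr; apply: ler_sum => U UD.
rewrite sumr_const big_split /= prodr_const -[leLHS]mulr_natr mulrCA.
apply: ler_wpM2l; first exact: prodr_ge0.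
have [Ub|bU] := leqP #|U| b; last first.
  rewrite [X in X%:R <= _]eq_card0 ?mulr_ge0 ?exprn_ge0 ?divr_ge0 // => B.
  apply/negP => /andP[/andP[_ /eqP Bb] /subset_leq_card].
  by rewrite Bb leqNgt bU.
rewrite [X in X%:R <= _](_ : _ = 'C(#|D| - #|U|, b - #|U|)) ?bin_sub_ratio //.
rewrite -card_subsets_between //; apply: eq_card => B.
by rewrite inE andbA.
Qed.

(** * Copies of a complete bipartite graph *)

Definition bip (n : nat) (A B : {set 'I_n}) : {set vpair n} :=
  [set e : vpair n | [exists x in A, [exists y in B, val e == [set x; y]]]].

(** The pairs are ordered, so that one part can be averaged out after the other; for [a = b] each
    copy is then counted twice. *)
Definition part_pairs (n a b : nat) : {set {set 'I_n} * {set 'I_n}} :=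
  [set z : {set 'I_n} * {set 'I_n} |
    [&& #|z.1| == a, #|z.2| == b & [disjoint z.1 & z.2]]].

Lemma vpairP (n : nat) (x y : 'I_n) :
  x != y -> exists e : vpair n, val e = [set x; y].
Proof.
move=> xy; have xy2 : #|[set x; y]| == 2%N by rewrite cards2 xy.
by exists (exist _ [set x; y] xy2).
Qed.

Lemma set2_inj (T : finType) (x y x' y' : T) : [set x; y] = [set x'; y'] ->
  x = x' /\ y = y' \/ x = y' /\ y = x'.
Proof.
move=> E.
have : x \in [set x'; y'] by rewrite -E set21.
have : y \in [set x'; y'] by rewrite -E set22.
have : x' \in [set x; y] by rewrite E set21.
have : y' \in [set x; y] by rewrite E set22.
rewrite !inE => /orP[]/eqP h1 /orP[]/eqP h2 /orP[]/eqP h3 /orP[]/eqP h4;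
  by [left; split; congruence|right; split; congruence].
Qed.

Lemma mem_bip (n : nat) (A B : {set 'I_n}) (x y : 'I_n) (e : vpair n) :
  val e = [set x; y] ->
  (e \in bip A B) = (x \in A) && (y \in B) || (x \in B) && (y \in A).
Proof.
move=> exy; rewrite inE; apply/existsP/orP.
  move=> [u /andP[uA /existsP[v /andP[vB]]]]; rewrite exy.
  by move=> /eqP/set2_inj[][-> ->]; [left|right]; rewrite ?uA ?vB.
case=> /andP[xA yB]; [exists x|exists y].
  by rewrite xA; apply/existsP; exists y; rewrite yB exy eqxx.
by rewrite yB; apply/existsP; exists x; rewrite xA exy setUC eqxx.
Qed.

(** The edge set determines adjacency. Fix [x] in [A] and [y] in [B]: the neighbours of [x] form [B]
    and those of [y] form [A], so the side on which [x] falls in the second pair decides between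
    equality and swap. *)
Lemma bip_inj (n : nat) (A B A' B' : {set 'I_n}) :
  [disjoint A & B] -> [disjoint A' & B'] -> A != set0 -> B != set0 ->
  bip A B = bip A' B' -> A = A' /\ B = B' \/ A = B' /\ B = A'.
Proof.
move=> dAB dAB' /set0Pn[x xA] /set0Pn[y yB] E.
(* Equality of edge sets, read on vertices; for [u = v] both sides are false because the parts are
   disjoint. *)
have key u v : (u \in A) && (v \in B) || (u \in B) && (v \in A)
             = (u \in A') && (v \in B') || (u \in B') && (v \in A').
  have [<-|uv] := eqVneq u v.
    have nAB (C D : {set 'I_n}) :
        [disjoint C & D] -> (u \in C) && (u \in D) = false.
      by move=> /disjoint_setI0/setP/(_ u); rewrite !inE.
    by rewrite ![(u \in _) && _]nAB // disjoint_sym.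
  by have [e ee] := vpairP uv; rewrite -!(mem_bip _ _ ee) E.
have nAB u : u \in A -> (u \in B) = false by move/(disjointFr dAB).
have nBA u : u \in B -> (u \in A) = false by move/(disjointFl dAB).
have nAB' u : u \in A' -> (u \in B') = false by move/(disjointFr dAB').
have nBA' u : u \in B' -> (u \in A') = false by move/(disjointFl dAB').
have /orP[xA'|xB'] : (x \in A') || (x \in B').
- have := key x y; rewrite xA yB /= => /esym/orP[]/andP[-> _] //.
  by rewrite orbT.
- have EB : B = B'.
    apply/setP => v; have := key x v.
    by rewrite xA xA' (nAB x xA) (nAB' x xA') /= !orbF.
  left; split=> //; apply/setP => u; have := key u y.
  have yB' : y \in B' by rewrite -EB.
  by rewrite yB yB' (nBA y yB) (nBA' y yB') !andbT !andbF !orbF.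
- have EB : B = A'.
    apply/setP => v; have := key x v.
    by rewrite xA xB' (nAB x xA) (nBA' x xB') /= !orbF.
  right; split=> //; apply/setP => u; have := key u y.
  have yA' : y \in A' by rewrite -EB.
  by rewrite yB yA' (nBA y yB) (nAB' y yA') !andbT !andbF !orbF.
Qed.

(** From a copy, the parts are the images of the two sides under the isomorphism; conversely,
    enumerating [A] and [B] gives the isomorphism. *)
Lemma copies_Kbip (n a b : nat) : (0 < a)%N -> (0 < b)%N ->
  copies (Kbip a b) n = [set (z.1 :|: z.2, bip z.1 z.2) | z in part_pairs n a b].
Proof.
move=> a0 b0; apply/setP => H; apply/idP/imsetP; rewrite inE.
  move=> /andP[/forallP sub /existsP[f /and3P[/injectiveP fi /eqP fH /forallP fadj]]].
  exists (f @: [set inl i | i : 'I_a], f @: [set inr i | i : 'I_b]).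
    rewrite inE /= !card_imset ?cardsT ?card_ord ?eqxx //=; try by move=> ? ? [].
    rewrite -setI_eq0; apply/eqP/setP => x; rewrite !inE.
    apply/negP => /andP[/imsetP[_ /imsetP[i _ ->] ->] /imsetP[_ /imsetP[j _ ->]]].
    by move/fi.
  rewrite [H]surjective_pairing /=; congr pair.
    apply/setP => x; rewrite -fH !inE; apply/imsetP/orP.
      by move=> [[i|i] _ ->]; [left|right]; rewrite !imset_f.
    by case=> /imsetP[u _ ->]; exists u.
  apply/setP => e; apply/idP/idP.
    move=> eH; have := sub e; rewrite eH /= => eH1.
    have /cards2P[x [y [xy exy]]] := valP e.
    have fx z : z \in val e -> exists u, z = f u.
      by move/(subsetP eH1); rewrite -fH => /imsetP[u _ ->]; exists u.
    have [u xu] : exists u, x = f u by apply: fx; rewrite exy set21.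
    have [v yv] : exists u, y = f u by apply: fx; rewrite exy set22.
    have /forallP/(_ v) := fadj u.
    rewrite -xu -yv [X in _ == X](_ : _ = true); last first.
      by apply/existsP; exists e; rewrite eH exy eqxx.
    rewrite (mem_bip _ _ exy) eqb_id xu yv.
    have fl i : f (inl i) \in [set f u | u in [set inl i | i : 'I_a]].
      by rewrite !imset_f.
    have fr i : f (inr i) \in [set f u | u in [set inr i | i : 'I_b]].
      by rewrite !imset_f.
    by case: u {xu} => i; case: v {yv} => j //= _; rewrite ?fl ?fr ?orbT.
  rewrite inE => /existsP[x /andP[/imsetP[_ /imsetP[i _ ->] ->]]].
  move=> /existsP[y /andP[/imsetP[_ /imsetP[j _ ->] ->]]] /eqP ee.
  have /forallP/(_ (inr j))/eqP/esym/existsP[e' /andP[e'H]] := fadj (inl i).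
  by rewrite -ee => /eqP/val_inj <-.
case=> -[A B]; rewrite inE /= => /and3P[/eqP cA /eqP cB dAB] -> /=.
have nAB u : u \in A -> (u \in B) = false by move/(disjointFr dAB).
have nBA u : u \in B -> (u \in A) = false by move/(disjointFl dAB).
apply/andP; split.
  apply/forallP => e; apply/implyP; rewrite inE.
  move=> /existsP[x /andP[xA /existsP[y /andP[yB /eqP ->]]]].
  by rewrite subUset !sub1set !inE xA yB orbT.
pose f : {ffun 'I_a + 'I_b -> 'I_n} := [ffun u : 'I_a + 'I_b => match u with
  | inl i => enum_val (cast_ord (esym cA) i)
  | inr j => enum_val (cast_ord (esym cB) j) end].
have fl i : f (inl i) \in A by rewrite ffunE enum_valP.
have fr i : f (inr i) \in B by rewrite ffunE enum_valP.
have fi : injective f.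
  move=> [i|i] [j|j] E.
  - by move: E; rewrite !ffunE => /enum_val_inj/cast_ord_inj ->.
  - by have := nAB _ (fl i); rewrite E fr.
  - by have := nBA _ (fr i); rewrite E fl.
  - by move: E; rewrite !ffunE => /enum_val_inj/cast_ord_inj ->.
apply/existsP; exists f; apply/and3P; split; first exact/injectiveP.
  rewrite eqEcard; apply/andP; split.
    by apply/subsetP => _ /imsetP[[i|i] _ ->]; rewrite inE ?fl ?fr ?orbT.
  rewrite card_imset // cardsT card_sum !card_ord cardsU.
  by rewrite (disjoint_setI0 dAB) cards0 subn0 cA cB.
apply/forallP => u; apply/forallP => v; apply/eqP.
have [->|uv] := eqVneq u v.
  transitivity false; first by case: v.
  apply/esym/negbTE/negP => /existsP[e /andP[_ /eqP ee]].
  have : #|val e| == 2%N := valP e.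
  by rewrite [val e]ee setUid cards1.
have fuv : f u != f v by apply: contra uv => /eqP/fi ->.
have [e ee] := vpairP fuv.
transitivity (e \in bip A B).
  rewrite (mem_bip _ _ ee).
  by case: u {uv fuv ee} => i; case: v => j;
     rewrite /= ?fl ?fr ?(nAB _ (fl _)) ?(nBA _ (fr _)) ?andbF.
apply/idP/existsP => [eb|[e' /andP[eb]]]; first by exists e; rewrite eb ee eqxx.
by rewrite -ee => /eqP/val_inj <-.
Qed.

(* A copy of K_{a,b} determines its two parts up to a swap, which is possible
   only when [a = b]. *)
Lemma sum_copies_Kbip (V : nmodType) (n a b : nat) (F : {set vpair n} -> V) :
  (0 < a)%N -> (0 < b)%N ->
  \sum_(z in part_pairs n a b) F (bip z.1 z.2) =
  (\sum_(H in copies (Kbip a b) n) F H.2) *+ (a == b).+1.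
Proof.
move=> a0 b0; rewrite copies_Kbip //.
rewrite (partition_big_imset (fun z => (z.1 :|: z.2, bip z.1 z.2))) /= -sumrMnl.
apply: eq_bigr => H /imsetP[[A B] zX ->].
under eq_bigr => z /andP[_ /eqP E] do (have [_ ->] := E).
rewrite sumr_const; congr (_ *+ _).
move: zX; rewrite inE => /= /and3P[cA cB dAB].
have An0 : A != set0 by rewrite -card_gt0 (eqP cA).
have Bn0 : B != set0 by rewrite -card_gt0 (eqP cB).
have AB : A != B.
  apply: contra An0 => /eqP E; move: dAB; rewrite E -setI_eq0 setIid.
  by rewrite -E.
(* The fibre over the copy with parts [A] and [B]. *)
transitivity #|if a == b then [set (A, B); (B, A)] else [set (A, B)]|; last first.
  case: ifP => _; last by rewrite cards1.
  by rewrite cards2 xpair_eqE negb_and AB.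
apply: eq_card => -[A' B']; rewrite -[LHS]/(_ && _) inE /=; apply/idP/idP.
  move=> /andP[/and3P[cA' cB' dAB']] /eqP[_ E].
  have [[EA EB]|[EA EB]] := bip_inj dAB dAB' An0 Bn0 (esym E).
    by rewrite EA EB; case: ifP; rewrite !inE eqxx.
  have -> : a == b by rewrite -(eqP cA) EA cB'.
  by rewrite EA EB !inE eqxx orbT.
case: ifP => [/eqP ab|_]; rewrite !inE; last first.
  by case/eqP=> -> ->; rewrite cA cB dAB /=.
case/orP => /eqP[-> ->]; first by rewrite cA cB dAB /=.
rewrite -ab in cB *; rewrite disjoint_sym cA cB dAB /= setUC; apply/eqP.
congr pair; apply/setP => e; have /cards2P[x [y [_ ee]]] := valP e.
by rewrite !(mem_bip _ _ ee) orbC.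
Qed.

Lemma card_copies_Kbip (n a b : nat) : (0 < a)%N -> (0 < b)%N ->
  #|part_pairs n a b| = (#|copies (Kbip a b) n| * (a == b).+1)%N.
Proof.
move=> a0 b0; rewrite -!sum1_card.
have := @sum_copies_Kbip nat n a b (fun=> 1%N) a0 b0.
by rewrite -mulr_natr natn.
Qed.

(** * Queried pairs at a vertex, stars and touching pairs *)

(** The 0/1 indicator that the pair of [u] and [v] is queried. Writing it as a sum over [Q] makes it
    total, also at [u = v], and ready for exchanging sums. *)
Definition inc (n : nat) (Q : {set vpair n}) (u v : 'I_n) : nat :=
  (\sum_(e in Q) (val e == [set u; v]))%N.

Lemma inc_le1 (n : nat) (Q : {set vpair n}) (u v : 'I_n) : (inc Q u v <= 1)%N.
Proof.
rewrite /inc -big_mkcondr /= sum1_card.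
apply/card_le1_eqP => e f /andP[_ /eqP ee] /andP[_ /eqP fe].
exact/val_inj/(etrans fe (esym ee)).
Qed.

(** Handshake count: each queried pair has two endpoints, and each endpoint determines the other. *)
Lemma sum_inc (n : nat) (Q : {set vpair n}) :
  (\sum_u \sum_v inc Q u v <= 2 * #|Q|)%N.
Proof.
have -> : (\sum_u \sum_v inc Q u v =
           \sum_(e in Q) \sum_u \sum_v (val e == [set u; v]))%N.
  by rewrite [RHS]exchange_big; apply: eq_bigr => u _; rewrite exchange_big.
rewrite mulnC -sum_nat_const; apply: leq_sum => e _.
have e2 : (2 = \sum_(u in val e) 1)%N.
  by rewrite sum1_card; apply/esym/eqP/(valP e).
rewrite [leqRHS]e2 [leqRHS]big_mkcond /=; apply: leq_sum => u _.
rewrite -big_mkcond /= sum1_card; case: ifP => ue.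
  apply/card_le1_eqP => v w ev ew.
  have {}ev : val e = [set u; v] by apply/eqP.
  have {}ew : val e = [set u; w] by apply/eqP.
  by have [[_ ->]|[<- ->]] := set2_inj (etrans (esym ev) ew).
rewrite eq_card0 // => v; apply/negP => ev; move: ue.
have {}ev : val e = [set u; v] by apply/eqP.
by rewrite ev set21.
Qed.

(** A common edge joins some [u] in [A] to some [v] in [B]. As [u] is not in [B'], membership in the
    second edge set forces [v] into [B']. *)
Lemma card_bipI (n : nat) (Q : {set vpair n}) (A B B' : {set 'I_n}) :
  [disjoint A & B'] ->
  (#|bip A B :&: bip A B' :&: Q| <=
   \sum_(v in B :&: B') \sum_(u in A) inc Q u v)%N.
Proof.
move=> dAB'.
have -> : (\sum_(v in B :&: B') \sum_(u in A) inc Q u v =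
  \sum_(e in Q) \sum_(v in B :&: B') \sum_(u in A) (val e == [set u; v]))%N.
  by rewrite [RHS]exchange_big; apply: eq_bigr => u _; rewrite exchange_big.
rewrite -sum1_card [leqLHS]big_mkcond [leqRHS]big_mkcond /=.
apply: leq_sum => e _; rewrite inE; case: (e \in Q); last by rewrite andbF.
rewrite andbT; case: ifP => //; rewrite inE => /andP[].
rewrite {1}inE => /existsP[u /andP[uA /existsP[v /andP[vB /eqP ee]]]].
rewrite (mem_bip _ _ ee) uA (disjointFr dAB' uA) /= orbF => vB'.
have vBB' : v \in B :&: B' by rewrite inE vB vB'.
by rewrite (bigD1 v) //= (bigD1 u) //= ee eqxx.
Qed.

Definition star (n : nat) (S : {set 'I_n}) (u : 'I_n) : {set vpair n} :=
  [set e : vpair n | [exists v in S :\ u, val e == [set u; v]]].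

(** The query set of the detection procedure; it contains the star from every vertex into [S]. *)
Definition touching (n : nat) (S : {set 'I_n}) : {set vpair n} :=
  [set e : vpair n | [exists v in S, v \in val e]].

Lemma star_touching (n : nat) (S : {set 'I_n}) (u : 'I_n) :
  star S u \subset touching S.
Proof.
apply/subsetP => e; rewrite !inE => /existsP[v /andP[]].
rewrite !inE => /andP[_ vS] /eqP ee.
by apply/existsP; exists v; rewrite vS ee set22.
Qed.

Lemma card_star (n : nat) (S : {set 'I_n}) (u : 'I_n) : (#|star S u| <= #|S|)%N.
Proof.
rewrite -(card_imset _ (val_inj : injective (val : vpair n -> {set 'I_n}))).
apply: leq_trans (leq_imset_card (fun v => [set u; v]) S).
apply/subset_leq_card/subsetP => _ /imsetP[e + ->]; rewrite inE.
move=> /existsP[v /andP[]]; rewrite !inE => /andP[_ vS] /eqP ->.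
by apply/imsetP; exists v.
Qed.

Lemma card_touching (n : nat) (S : {set 'I_n}) : (#|touching S| <= #|S| * n)%N.
Proof.
rewrite -(card_imset _ (val_inj : injective (val : vpair n -> {set 'I_n}))).
rewrite -[X in (_ <= _ * X)%N]card_ord -cardsT -cardsX.
apply: leq_trans (leq_imset_card (fun z => [set z.1; z.2]) _).
apply/subset_leq_card/subsetP => _ /imsetP[e + ->]; rewrite inE.
move=> /existsP[v /andP[vS]].
have /cards2P[x [y [_ ee]]] := valP e.
rewrite [val e]ee !inE => /orP[]/eqP E; subst v.
  by apply/imsetP; exists (x, y); rewrite ?inE ?vS.
by apply/imsetP; exists (y, x); rewrite ?inE ?vS //= setUC.
Qed.

(** All of [B :&: S] is adjacent to [u] in the planted copy, and sending [v] to the pair of [u] and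
    [v] is injective there. *)
Lemma card_star_bip (n : nat) (S A B : {set 'I_n}) (u : 'I_n) :
  [disjoint A & B] -> u \in A -> (#|B :&: S| <= #|star S u :&: bip A B|)%N.
Proof.
move=> dAB uA; have uB := disjointFr dAB uA.
rewrite -(card_in_imset (f := fun v => [set u; v])); last first.
  move=> v w; rewrite inE => /andP[vB _] _ /set2_inj[][// _ E].
  by rewrite E uB in vB.
rewrite -[leqRHS](card_imset _ (val_inj : injective (val : vpair n -> {set 'I_n}))).
apply/subset_leq_card/subsetP => _ /imsetP[v + ->].
rewrite inE => /andP[vB vS].
have uv : u != v by apply: contraFneq uB => ->.
have [e ee] := vpairP uv; apply/imsetP; exists e => //.
rewrite inE (mem_bip _ _ ee) uA vB /= andbT inE.
by apply/existsP; exists v; rewrite !inE eq_sym uv vS ee /=.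
Qed.

(** * Averaging over the two parts; moments of random subsets *)

Lemma sum_part_pairs (V : nmodType) (n a b : nat)
    (F : {set 'I_n} -> {set 'I_n} -> V) :
  \sum_(z in part_pairs n a b) F z.1 z.2 =
  \sum_(A : {set 'I_n} | #|A| == a)
    \sum_(B : {set 'I_n} | (B \subset ~: A) && (#|B| == b)) F A B.
Proof.
rewrite pair_big_dep /=; apply: eq_bigl => -[A B]; rewrite inE /=.
by rewrite disjoint_sym disjoints_subset andbCA andbC -andbA.
Qed.

(** Allows the large part to be drawn first, which makes its marginal law visibly uniform. *)
Lemma sum_part_pairs_swap (V : nmodType) (n a b : nat)
    (F : {set 'I_n} -> {set 'I_n} -> V) :
  \sum_(z in part_pairs n a b) F z.1 z.2 =
  \sum_(z in part_pairs n b a) F z.2 z.1.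
Proof.
rewrite (reindex_inj (h := fun z => (z.2, z.1))) /=; last first.
  by move=> [? ?] [? ?] [-> ->].
by apply: eq_bigl => z; rewrite !inE /= disjoint_sym andbCA.
Qed.

Lemma card_part_pairs (n a b : nat) :
  #|part_pairs n a b| = ('C(n, a) * 'C(n - a, b))%N.
Proof.
rewrite -sum1_card; have := @sum_part_pairs nat n a b (fun _ _ => 1%N).
rewrite /= => ->.
rewrite -[in 'C(n, a)](card_ord n) -card_draws -sum1dep_card big_distrl /=.
apply: eq_bigr => A /eqP cA; rewrite mul1n.
have -> : (n - a)%N = #|~: A| by rewrite -cA -{1}(card_ord n) -(cardsC A) addKn.
by rewrite -cards_draws sum1dep_card.
Qed.

Lemma card_supersets_le (R : realFieldType) (T : finType) (U : {set T})
    (b : nat) :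
  (b <= #|T|)%N ->
  #|[set B : {set T} | (#|B| == b) && (U \subset B)]|%:R <=
  'C(#|T|, b)%:R * (b%:R / #|T|%:R) ^+ #|U| :> R.
Proof.
move=> bT; have [Ub|bU] := leqP #|U| b; last first.
  rewrite [X in X%:R <= _]eq_card0 ?mulr_ge0 ?exprn_ge0 ?divr_ge0 // => B.
  rewrite inE; apply/negP => /andP[/eqP Bb /subset_leq_card].
  by rewrite Bb leqNgt bU.
rewrite [X in X%:R <= _](_ : _ = 'C(#|T| - #|U|, b - #|U|)) ?bin_sub_ratio //.
rewrite -cardsT -card_subsets_between ?subsetT //; apply: eq_card => B.
by rewrite !inE subsetT.
Qed.

(** Two applications of [sum_subsets_prod_le]: averaging over [B'] multiplies each weight on [B] by
    [b / #|D|], and averaging over [B] multiplies it once more. *)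
Lemma sum_subsets_overlap_le (R : realFieldType) (T : finType) (D : {set T})
    (b : nat) (w : T -> R) :
  (forall v, 0 <= w v) -> (b <= #|D|)%N ->
  \sum_(B : {set T} | (B \subset D) && (#|B| == b))
    \sum_(B' : {set T} | (B' \subset D) && (#|B'| == b))
      \prod_(v in B :&: B') (1 + w v) <=
  'C(#|D|, b)%:R ^+ 2 * \prod_(v in D) (1 + w v * (b%:R / #|D|%:R) ^+ 2).
Proof.
move=> w0 bD; set beta := b%:R / #|D|%:R.
have beta0 : 0 <= beta by rewrite divr_ge0.
have step (B : {set T}) : B \subset D ->
    \sum_(B' : {set T} | (B' \subset D) && (#|B'| == b))
      \prod_(v in B :&: B') (1 + w v) <=
    'C(#|D|, b)%:R * \prod_(v in B) (1 + w v * beta).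
  (* With the weights cut off outside [B], the product over [B :&: B'] becomes one over [B']. *)
  move=> BD; pose wB v := if v \in B then w v else 0.
  have wB0 v : 0 <= wB v by rewrite /wB; case: ifP.
  have := sum_subsets_prod_le wB0 bD.
  rewrite -/beta.
  have -> : \prod_(v in D) (1 + wB v * beta) = \prod_(v in B) (1 + w v * beta).
    rewrite [LHS]big_mkcond [RHS]big_mkcond /=; apply: eq_bigr => v _.
    rewrite /wB; case: (boolP (v \in B)) => [/(subsetP BD) -> //|_].
    by rewrite mul0r addr0; case: ifP.
  apply: le_trans; apply: ler_sum => B' _.
  rewrite [leLHS]big_mkcond [leRHS]big_mkcond /=.
  rewrite (eq_bigr (fun v => if v \in B' then 1 + wB v else 1)) // => v _.
  by rewrite inE /wB; case: (v \in B); rewrite ?addr0; case: (v \in B').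
apply: (@le_trans _ _ (\sum_(B : {set T} | (B \subset D) && (#|B| == b))
    'C(#|D|, b)%:R * \prod_(v in B) (1 + w v * beta))).
  by apply: ler_sum => B /andP[BD _]; exact: step.
rewrite -mulr_sumr expr2 -mulrA ler_wpM2l //.
have wb0 v : 0 <= w v * beta by rewrite mulr_ge0.
apply: le_trans (sum_subsets_prod_le wb0 bD) _.
rewrite ler_wpM2l // le_eqVlt; apply/orP; left; apply/eqP.
by apply: eq_bigr => v _; rewrite -/beta expr2 -mulrA.
Qed.

Lemma sum_draws_sum_le (R : realFieldType) (T : finType) (a : nat) (d : T -> R) :
  (forall u, 0 <= d u) -> (a <= #|T|)%N ->
  \sum_(A : {set T} | #|A| == a) \sum_(u in A) d u <=
  'C(#|T|, a)%:R * (a%:R / #|T|%:R) * \sum_u d u.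
Proof.
move=> d0 aT; rewrite (exchange_big_dep xpredT) //= mulr_sumr.
apply: ler_sum => u _; rewrite sumr_const -[leLHS]mulr_natl ler_wpM2r //.
have := card_supersets_le R [set u] aT; rewrite cards1 expr1.
apply: le_trans; rewrite ler_nat; apply/subset_leq_card/subsetP => B.
by rewrite inE sub1set.
Qed.

(** Membership indicators of distinct points in a uniform [b]-subset are not positively correlated,
    so the variance of [#|B :&: S|] is at most its mean. *)
Lemma sum_draws_variance_le (R : realFieldType) (T : finType) (b : nat)
    (S : {set T}) :
  (0 < b)%N -> (b <= #|T|)%N ->
  \sum_(B : {set T} | #|B| == b)
    (#|B :&: S|%:R - #|S|%:R * b%:R / #|T|%:R) ^+ 2 <=
  'C(#|T|, b)%:R * (#|S|%:R * b%:R / #|T|%:R) :> R.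
Proof.
move=> b0 bT; set beta : R := b%:R / #|T|%:R; set c : R := 'C(#|T|, b)%:R.
have T0 : #|T|%:R != 0 :> R by rewrite pnatr_eq0 -lt0n; lia.
(* An exact value is required here, since the mean enters the variance with a negative sign. *)
have one v : #|[set B : {set T} | (#|B| == b) && (v \in B)]|%:R = c * beta.
  rewrite [X in X%:R](_ : _ = 'C(#|T| - 1, b - 1)); last first.
    rewrite -(cards1 v) -cardsT -card_subsets_between ?subsetT ?cards1 //.
    by apply: eq_card => B; rewrite !inE subsetT sub1set.
  apply: (mulfI T0); rewrite /c /beta mulrCA [_ * (_ / _)]mulrC divfK //.
  rewrite -!natrM; congr _%:R; rewrite subn1.
  by rewrite -[in 'C(_, b - 1)](ltn_predK b0) mul_bin_diag subn1 /= mulnC ?prednK.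
have cardI (B : {set T}) : #|B :&: S|%:R = \sum_(v in S) (v \in B)%:R :> R.
  rewrite -natr_sum; congr _%:R; rewrite -sum1_card -big_mkcondr /=.
  by apply: eq_bigl => v; rewrite inE andbC.
have s1 : \sum_(B : {set T} | #|B| == b) #|B :&: S|%:R = c * (#|S|%:R * beta).
  under eq_bigr do rewrite cardI.
  rewrite exchange_big /= -[RHS]mulrCA mulr_natl -sumr_const.
  apply: eq_bigr => v _; rewrite -(one v) -natr_sum -big_mkcondr /=.
  by rewrite sum1dep_card.
have s2 : \sum_(B : {set T} | #|B| == b) #|B :&: S|%:R ^+ 2 <=
    c * (#|S|%:R * beta) + c * (#|S|%:R * beta) ^+ 2.
  under eq_bigr => B _.
    rewrite expr2 {1}cardI mulr_suml.
    under eq_bigr => v _ do rewrite cardI mulr_sumr.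
    over.
  rewrite exchange_big /=.
  have -> : c * (#|S|%:R * beta) + c * (#|S|%:R * beta) ^+ 2 =
      \sum_(v in S) (c * beta + \sum_(w in S) c * beta ^+ 2).
    by rewrite !sumr_const; ring.
  (* The diagonal term [w = v] gives [c * beta]; each off-diagonal term is at most
     [c * beta ^+ 2]. *)
  apply: ler_sum => v vS; rewrite exchange_big /= (bigD1 v) //= lerD //.
    rewrite -(one v) -sum1dep_card big_mkcondr /= natr_sum.
    by apply: ler_sum => B _; rewrite -natrM; case: (v \in B).
  apply: (@le_trans _ _ (\sum_(w in S | w != v) c * beta ^+ 2)).
    apply: ler_sum => w /andP[_ wv].
    have := card_supersets_le R [set v; w] bT.
    rewrite cards2 eq_sym wv; apply: le_trans.
    rewrite -sum1dep_card big_mkcondr /= natr_sum; apply: ler_sum => B _.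
    by rewrite subUset !sub1set -natrM; case: (v \in B); case: (w \in B).
  rewrite [leRHS](bigD1 v) //= ler_wpDl //.
  by rewrite mulr_ge0 // exprn_ge0 // divr_ge0.
have -> : #|S|%:R * b%:R / #|T|%:R = #|S|%:R * beta by rewrite mulrA.
set mu := #|S|%:R * beta in s1 s2 *.
have s0 : \sum_(B : {set T} | #|B| == b) (1 : R) = c.
  by rewrite sumr_const /c -card_draws; congr _%:R; apply: eq_card => B; rewrite inE.
have -> : \sum_(B : {set T} | #|B| == b) (#|B :&: S|%:R - mu) ^+ 2 =
   \sum_(B : {set T} | #|B| == b) #|B :&: S|%:R ^+ 2
   - 2 * mu * \sum_(B : {set T} | #|B| == b) #|B :&: S|%:R
   + mu ^+ 2 * \sum_(B : {set T} | #|B| == b) (1 : R).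
  rewrite !mulr_sumr -sumrB -big_split /=; apply: eq_bigr => B _; ring.
rewrite s0 s1; lra.
Qed.

(** * Null and planted laws *)

From mathcomp Require Import all_classical all_reals all_analysis.
Import numFieldNormedType.Exports.

(** Independence of the pairs: a sum over graphs of a product over pairs factorises. *)
Lemma sum_graphs_prod (R : comPzRingType) (n : nat) (g : vpair n -> bool -> R) :
  \sum_(G : graph n) \prod_e g e (e \in G) = \prod_e (g e true + g e false).
Proof.
rewrite bigA_distr; apply: eq_bigr => G _; apply: eq_bigr => e _.
by case: (e \in G).
Qed.

Lemma law_H0E (R : realType) (q : R) (n : nat) (G : graph n) :
  law_H0 q G = law_planted q finset.set0 G.
Proof. by apply: eq_bigr => e _; rewrite finset.in_set0. Qed.

(** The multiplicity of each copy among the ordered pairs of parts is constant, so it cancels in the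
    normalisation. *)
Lemma law_H1_Kbip (R : realType) (q : R) (n a b : nat) (G : graph n) :
  (0 < a)%N -> (0 < b)%N ->
  law_H1 q (Kbip a b) G =
  \sum_(z in part_pairs n a b)
    (#|part_pairs n a b|%:R)^-1 * law_planted q (bip z.1 z.2) G.
Proof.
move=> a0 b0; rewrite /law_H1 -mulr_sumr.
rewrite (@sum_copies_Kbip R n a b (fun S => law_planted q S G)) //.
rewrite card_copies_Kbip // natrM invfM -mulrA; congr (_ * _).
by rewrite -[X in _ = _ * X]mulr_natl mulKf // pnatr_eq0.
Qed.

Section law.
Context (R : realType) (q : R) (hq : 0 < q < 1).

Lemma edge_law_gt0 b : 0 < edge_law q b.
Proof. by move: hq; rewrite /edge_law; case: b; lra. Qed.

Lemma law_H0_gt0 (n : nat) (G : graph n) : 0 < law_H0 q G.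
Proof. by apply: prodr_gt0 => e _; exact: edge_law_gt0. Qed.

Lemma law_planted_ge0 (n : nat) (S : {set vpair n}) (G : graph n) :
  0 <= law_planted q S G.
Proof.
by apply: prodr_ge0 => e _; case: ifP => _; rewrite ?ler0n // ltW // edge_law_gt0.
Qed.

Lemma law_planted_sum1 (n : nat) (S : {set vpair n}) :
  \sum_(G : graph n) law_planted q S G = 1.
Proof.
rewrite (sum_graphs_prod (fun e b => if e \in S then b%:R else edge_law q b)).
by apply: big1 => e _; rewrite /edge_law; case: ifP => _ /=; ring.
Qed.

Lemma law_H0_sum1 (n : nat) : \sum_(G : graph n) law_H0 q G = 1.
Proof.
rewrite -(@law_planted_sum1 n finset.set0).
by apply: eq_bigr => G _; rewrite law_H0E.
Qed.

Lemma sum_transcript_law (n : nat) (P : graph n -> R) (Q : {set vpair n})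
    (phi : pred (transcript_type Q)) :
  \sum_(t | phi t) transcript_law P t = \sum_(G | phi (transcript Q G)) P G.
Proof.
rewrite [RHS](partition_big (transcript Q) phi) //=.
apply: eq_bigr => t pt; apply: eq_bigl => G.
by case: eqP => [->|]; rewrite ?pt ?andbF.
Qed.

(** An unqueried pair contributes total mass 1 whether planted or not. Hence the planted set may be
    cut down to [Q], and later overlaps count queried pairs only. *)
Lemma transcript_law_planted (n : nat) (S Q : {set vpair n})
    (t : transcript_type Q) :
  transcript_law (law_planted q S) t =
  transcript_law (law_planted q (S :&: Q)%SET) t.
Proof.
(* Compatibility of the status [b] of [e] with the transcript; unqueried pairs are always
   compatible. *)
pose ok e (b : bool) := if insub e is Some e' then t e' == b else true.
have okP G : (transcript Q G == t) = [forall e, ok e (e \in G)].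
  apply/eqP/forallP => [E e|H].
    by rewrite /ok; case: insubP => // e' _ <-; rewrite -E ffunE.
  apply/ffunP => e; rewrite ffunE; have := H (val e).
  by rewrite /ok valK => /eqP ->.
have E S' : transcript_law (law_planted q S') t = \prod_e
   ((ok e true)%:R * (if e \in S' then 1 else q) +
    (ok e false)%:R * (if e \in S' then 0 else 1 - q)).
  rewrite -(sum_graphs_prod (fun e b => (ok e b)%:R *
    (if e \in S' then b%:R else edge_law q b))).
  rewrite /transcript_law big_mkcond; apply: eq_bigr => G _.
  rewrite big_split /= okP; case: forallP => [H|/forallP/forallPn[e /negbTE ne]].
    by rewrite [X in X * _]big1 ?mul1r // => e _; rewrite H.
  by rewrite (bigD1 e) //= ne !mul0r.
rewrite !E; apply: eq_bigr => e _; rewrite inE.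
case: (boolP (e \in Q)) => eQ; first by rewrite andbT.
rewrite andbF /ok insubN //.
by case: (e \in S); ring.
Qed.

(** * Total variation and second moments *)

Lemma dTV_ge0 (T : finType) (P P' : T -> R) : 0 <= dTV P P'.
Proof. by rewrite mulr_ge0 ?invr_ge0 ?ler0n // sumr_ge0. Qed.

(** Data processing: the transcript is a function of the graph, so the triangle inequality applies
    on each fibre. *)
Lemma dTV_transcript_le (n : nat) (P P' : graph n -> R) (Q : {set vpair n}) :
  dTV (transcript_law P (Q := Q)) (transcript_law P' (Q := Q)) <= dTV P P'.
Proof.
rewrite ler_wpM2l ?invr_ge0 ?ler0n //.
rewrite [leRHS](partition_big (transcript Q) xpredT) //=.
by apply: ler_sum => t _; rewrite /transcript_law -sumrB ler_norm_sum.
Qed.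

Lemma dTV_le1 (T : finType) (P P' : T -> R) :
  (forall t, 0 <= P t) -> (forall t, 0 <= P' t) ->
  \sum_t P t = 1 -> \sum_t P' t = 1 -> dTV P P' <= 1.
Proof.
move=> P0 P0' P1 P1'; rewrite /dTV ler_pdivrMl // mulr1.
apply: (@le_trans _ _ (\sum_t (P t + P' t))).
  apply: ler_sum => t _; apply: le_trans (ler_normB _ _) _.
  by rewrite !ger0_norm.
by rewrite big_split /= P1 P1'.
Qed.

Lemma dTV_mixture_le (I T : finType) (D : pred I) (w : I -> R)
    (P : I -> T -> R) (P' : T -> R) :
  (forall i, D i -> 0 <= w i) -> \sum_(i | D i) w i = 1 ->
  dTV (fun t => \sum_(i | D i) w i * P i t) P' <=
  \sum_(i | D i) w i * dTV (P i) P'.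
Proof.
move=> w0 w1; rewrite /dTV.
have -> : \sum_(i | D i) w i * (2^-1 * \sum_t `|P i t - P' t|) =
          2^-1 * \sum_(i | D i) w i * \sum_t `|P i t - P' t|.
  by rewrite mulr_sumr; apply: eq_bigr => i _; rewrite mulrCA.
rewrite ler_wpM2l ?invr_ge0 ?ler0n //.
under [leRHS]eq_bigr do rewrite mulr_sumr.
rewrite [leRHS]exchange_big /=; apply: ler_sum => t _.
rewrite -[X in `|_ - X|]mul1r -{1}w1 mulr_suml -sumrB.
apply: le_trans (ler_norm_sum _ _ _) _.
by apply: ler_sum => i Di; rewrite -mulrBr normrM ger0_norm ?w0.
Qed.

(* AM-GM: [2 |P - P'| <= delta P' + (P - P')^2 / (delta P')]; summing over a
   free parameter [delta] instead of using Cauchy-Schwarz avoids square roots. *)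
Lemma dTV_le_chi2 (T : finType) (P P' : T -> R) (delta : R) :
  0 < delta -> (forall t, 0 < P' t) -> \sum_t P t = 1 -> \sum_t P' t = 1 ->
  dTV P P' <= (delta + (\sum_t P t ^+ 2 / P' t - 1) / delta) / 4.
Proof.
move=> d0 P0' P1 P1'.
have -> : (delta + (\sum_t P t ^+ 2 / P' t - 1) / delta) / 4 =
  2^-1 * \sum_t (2^-1 * (delta * P' t + (P t - P' t) ^+ 2 / P' t / delta)).
  rewrite -mulr_sumr big_split /= -mulr_sumr -mulr_suml P1'.
  have -> : \sum_t (P t - P' t) ^+ 2 / P' t = \sum_t P t ^+ 2 / P' t - 1.
    transitivity (\sum_t (P t ^+ 2 / P' t - 2 * P t + P' t)).
      by apply: eq_bigr => t _; field; rewrite gt_eqF.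
    rewrite big_split sumrB /= -mulr_sumr P1 P1'; ring.
  by field; rewrite gt_eqF.
rewrite ler_wpM2l ?invr_ge0 ?ler0n //; apply: ler_sum => t _.
set x := `|_|; have -> : (P t - P' t) ^+ 2 = x ^+ 2 by rewrite real_normK ?num_real.
have y0 := P0' t; set y := P' t in y0 *.
rewrite -subr_ge0.
have -> : 2^-1 * (delta * y + x ^+ 2 / y / delta) - x =
   (delta * y - x) ^+ 2 / (2 * delta * y).
  by field; rewrite !gt_eqF.
by rewrite divr_ge0 ?sqr_ge0 // !mulr_ge0 // ltW.
Qed.

(** The sum factorises over pairs: a pair in both sets contributes [q / q ^+ 2], any other pair
    contributes 1. *)
Lemma planted_overlap (n : nat) (S S' : {set vpair n}) :
  \sum_(G : graph n) law_planted q S G * law_planted q S' G / law_H0 q G =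
  q^-1 ^+ #|(S :&: S')%SET|.
Proof.
rewrite -prodr_const [RHS]big_mkcond /=.
pose g e (b : bool) := (if e \in S then b%:R else edge_law q b) *
  (if e \in S' then b%:R else edge_law q b) / edge_law q b.
transitivity (\sum_(G : graph n) \prod_e g e (e \in G)).
  by apply: eq_bigr => G _; rewrite -big_split /= -prodf_div.
rewrite sum_graphs_prod /g; apply: eq_bigr => e _; rewrite inE /edge_law.
have ? : q != 0 by move: hq => /andP[/gt_eqF->].
have ? : 1 - q != 0 by rewrite subr_eq0 eq_sym; move: hq => /andP[_ /lt_eqF->].
by case: (e \in S); case: (e \in S') => /=; field; rewrite //; apply/andP.
Qed.
End law.

(** * Impossibility *)

(** From [expR (- y) >= 1 - y], since [(1 + y + 2 * y ^+ 2) * (1 - y) = 1 + y ^+ 2 * (1 - 2 *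
    y)]. *)
Lemma expR_le_quadratic (R : realType) (y : R) :
  y <= 2^-1 -> expR y <= 1 + y + 2 * y ^+ 2.
Proof.
move=> y2; have h : 0 < 1 - y by lra.
have : expR y <= (1 - y)^-1.
  rewrite -[y in leLHS]opprK expRN lef_pV2 ?posrE ?expR_gt0 //.
  exact: expR_ge1Dx.
move/le_trans; apply; rewrite -[_^-1]mul1r ler_pdivrMr //.
have := sqr_ge0 y; nra.
Qed.

Section impossibility.
Context (R : realType) (q : R) (hq : 0 < q < 1).

Let q0 : 0 < q. Proof. by case/andP: hq. Qed.
Let p1 : 1 <= q^-1. Proof. by rewrite invf_ge1 // ltW //; case/andP: hq. Qed.

(** Squaring the mixture produces two independent replicas [i] and [j], each pair of which is
    evaluated by [planted_overlap]. *)
Lemma planted_mixture_chi2 (n : nat) (I : finType) (D : pred I) (c : R)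
    (S : I -> {set vpair n}) :
  \sum_(G : graph n) (\sum_(i | D i) c * law_planted q (S i) G) ^+ 2 / law_H0 q G =
  c ^+ 2 * \sum_(i | D i) \sum_(j | D j) q^-1 ^+ #|(S i :&: S j)%SET|.
Proof.
transitivity (\sum_(i | D i) \sum_(j | D j) \sum_(G : graph n)
  c ^+ 2 * (law_planted q (S i) G * law_planted q (S j) G / law_H0 q G)).
  under [RHS]eq_bigr do rewrite exchange_big /=.
  rewrite [RHS]exchange_big /=; apply: eq_bigr => G _.
  rewrite expr2 !mulr_suml; apply: eq_bigr => i _.
  rewrite -mulrA mulr_suml mulr_sumr; apply: eq_bigr => j _; ring.
rewrite mulr_sumr; apply: eq_bigr => i _; rewrite mulr_sumr; apply: eq_bigr => j _.
by rewrite -mulr_sumr planted_overlap.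
Qed.

Lemma chi2_given_center_le (n b a0 : nat) (Q : {set vpair n}) (A : {set 'I_n}) :
  (#|A| <= a0)%N -> (b <= #|(~: A)%SET|)%N ->
  \sum_(G : graph n) (\sum_(B : {set 'I_n} | (B \subset ~: A)%SET && (#|B| == b))
     ('C(#|(~: A)%SET|, b)%:R)^-1 * law_planted q (bip A B :&: Q)%SET G) ^+ 2
       / law_H0 q G <=
  expR ((b%:R / #|(~: A)%SET|%:R) ^+ 2 * q^-1 ^+ a0 *
        (\sum_(u in A) \sum_v inc Q u v)%:R).
Proof.
move=> Aa0 bD; rewrite planted_mixture_chi2.
set D := (~: A)%SET in bD *; set beta := b%:R / #|D|%:R.
(* [c v] counts the queried pairs from [v] to [A]. The overlap exponent is at most the sum of [c]
   over [B :&: B'], so [1 + w v] is the factor of a common vertex [v]. *)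
pose c v := (\sum_(u in A) inc Q u v)%N.
have ca0 v : (c v <= a0)%N.
  apply: leq_trans Aa0; rewrite -sum1_card; apply: leq_sum => u _; exact: inc_le1.
pose w v : R := q^-1 ^+ c v - 1.
have w0 v : 0 <= w v by rewrite subr_ge0 exprn_ege1.
(* Linearisation in [c v], which ultimately turns the exponent into a sum of query degrees over
   [A]. *)
have wle v : w v <= q^-1 ^+ a0 * (c v)%:R.
  have [c0|cpos] := posnP (c v); first by rewrite /w c0 expr0 subrr mulr0.
  rewrite /w lerBlDr; apply: (@le_trans _ _ (q^-1 ^+ a0)).
    by apply: ler_weXn2l.
  rewrite -[leLHS]mulr1 ler_wpDr // ler_wpM2l ?exprn_ge0 ?(le_trans ler01) //.
  by rewrite ler1n.
have C0 : 0 < 'C(#|D|, b)%:R :> R by rewrite ltr0n bin_gt0.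
rewrite [X in X * _]exprVn ler_pdivrMl ?exprn_gt0 //.
apply: (@le_trans _ _ (\sum_(B : {set 'I_n} | (B \subset D) && (#|B| == b))
    \sum_(B' : {set 'I_n} | (B' \subset D) && (#|B'| == b))
      \prod_(v in (B :&: B')%SET) (1 + w v))).
  apply: ler_sum => B /andP[BD _]; apply: ler_sum => B' /andP[B'D _].
  under [leRHS]eq_bigr do rewrite addrC subrK.
  rewrite -expr_sum; apply: ler_weXn2l => //.
  have dAB' : [disjoint A & B'] by rewrite disjoint_sym finset.disjoints_subset.
  by apply: leq_trans (card_bipI Q B dAB'); rewrite finset.setIACA finset.setIid.
apply: le_trans (sum_subsets_overlap_le w0 bD) _.
rewrite -/beta ler_wpM2l ?exprn_ge0 ?ler0n //.
apply: (@le_trans _ _ (\prod_(v in D) expR (beta ^+ 2 * q^-1 ^+ a0 * (c v)%:R))).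
  apply: ler_prod => v _; rewrite addr_ge0 ?mulr_ge0 ?sqr_ge0 //=.
  apply: le_trans (expR_ge1Dx _) _; rewrite ler_expR.
  by rewrite mulrC -mulrA ler_wpM2l ?sqr_ge0.
rewrite -expR_sum ler_expR -mulr_sumr ler_wpM2l ?mulr_ge0 ?sqr_ge0 //.
  by rewrite exprn_ge0 ?(le_trans ler01).
rewrite -natr_sum ler_nat exchange_big /=; apply: leq_sum => u _.
by rewrite [leqRHS](bigID (mem D)) leq_addr.
Qed.

(** The bound is linear in the query degrees of [A], so averaging over [A] later requires only their
    mean and no exponential moment. *)
Lemma dTV_given_center_le (n b a0 : nat) (Q : {set vpair n}) (A : {set 'I_n})
    (delta : R) :
  0 < delta <= 1 -> (#|A| <= a0)%N -> (b <= #|(~: A)%SET|)%N ->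
  dTV (fun G : graph n => \sum_(B : {set 'I_n} | (B \subset ~: A)%SET && (#|B| == b))
     ('C(#|(~: A)%SET|, b)%:R)^-1 * law_planted q (bip A B :&: Q)%SET G)
      (@law_H0 R q n) <=
  delta + 2 / delta * ((b%:R / #|(~: A)%SET|%:R) ^+ 2 * q^-1 ^+ a0 *
        (\sum_(u in A) \sum_v inc Q u v)%:R).
Proof.
move=> /andP[d0 d1] Aa0 bD.
have chi := chi2_given_center_le Q Aa0 bD.
set x := (_ * _%:R) in chi *; set P := (fun G : graph n => _).
have x0 : 0 <= x.
  rewrite !mulr_ge0 ?sqr_ge0 // exprn_ge0 ?(le_trans ler01) //.
have C0 : 'C(#|(~: A)%SET|, b)%:R != 0 :> R by rewrite pnatr_eq0 -lt0n bin_gt0.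
have Psum : \sum_G P G = 1.
  rewrite exchange_big /=.
  under eq_bigr => B _ do rewrite -mulr_sumr law_planted_sum1 mulr1.
  rewrite sumr_const -cards_draws.
  rewrite [X in _ *+ X](_ : _ =
    #|[set B : {set 'I_n} | B \subset ~: A & #|B| == b]%SET|).
    by rewrite cards_draws -[LHS]mulr_natr mulVf.
  by apply: eq_card => B; rewrite [RHS]inE.
have P0 G : 0 <= P G.
  by apply: sumr_ge0 => B _; rewrite mulr_ge0 ?invr_ge0 ?ler0n ?law_planted_ge0.
have H0 (G : graph n) : 0 < law_H0 q G by exact: law_H0_gt0.
(* The second moment is useful only for small [x]; otherwise the claimed bound
   exceeds 1. *)
have [x2|x2] := leP x 2^-1.
  apply: le_trans (dTV_le_chi2 d0 H0 Psum (law_H0_sum1 q n)) _.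
  have ex := expR_le_quadratic x2.
  have {}chi : \sum_t P t ^+ 2 / law_H0 q t - 1 <= 2 * x.
    rewrite lerBlDr; apply: (le_trans chi); apply: (le_trans ex).
    have : 0 <= x * (2^-1 - x) by rewrite mulr_ge0 // subr_ge0.
    nra.
  rewrite [2 / delta * x]mulrAC.
  have xd0 : 0 <= 2 * x / delta by rewrite divr_ge0 ?(ltW d0) // mulr_ge0.
  have : (\sum_t P t ^+ 2 / law_H0 q t - 1) / delta <= 2 * x / delta.
    by rewrite ler_pM2r // invr_gt0.
  lra.
apply: (@le_trans _ _ 1).
  apply: dTV_le1 => //; last exact: law_H0_sum1.
  by move=> G; exact: ltW.
rewrite ler_wpDl ?(ltW d0) // mulrAC ler_pdivlMr // mul1r.
lra.
Qed.

(** The constant 16 collects 2 from [2 / delta], 4 from replacing [n - a] by [n / 2] in the square,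
    and 2 from the handshake count. *)
Lemma dTV_le_budget (n a b a0 : nat) (Q : {set vpair n}) (delta : R) :
  0 < delta <= 1 -> (0 < a)%N -> (a <= b)%N -> (a + b <= n)%N -> (a <= a0)%N ->
  dTV (transcript_law (law_H1 q (Kbip a b) (n := n)) (Q := Q))
      (transcript_law (@law_H0 R q n) (Q := Q)) <=
  delta + 16 * a0%:R * q^-1 ^+ a0 / delta * (b%:R ^+ 2 / n%:R ^+ 3) * #|Q|%:R.
Proof.
move=> hd apos ab abn aa0.
have an : (a <= n)%N := leq_trans (leq_addr _ _) abn.
have npos : (0 < n)%N := leq_trans apos an.
have bna : (b <= n - a)%N by rewrite leq_subRL.
have bpos : (0 < b)%N := leq_trans apos ab.
(* As [a <= b] and [a + b <= n], the small part takes at most half of the vertices. *)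
have bn2 : (b * n <= 2 * b * (n - a))%N by nia.
have /andP[d0 d1] := hd.
pose w : R := 'C(n, a)%:R^-1.
(* The planted law given the small part [A], restricted to queried pairs; [P'] is its average over
   [A]. *)
pose PA (A : {set 'I_n}) (G : graph n) : R :=
  \sum_(B : {set 'I_n} | (B \subset ~: A)%SET && (#|B| == b))
     ('C(#|(~: A)%SET|, b)%:R)^-1 * law_planted q (bip A B :&: Q)%SET G.
pose P' (G : graph n) : R := \sum_(A : {set 'I_n} | #|A| == a) w * PA A G.
have cardC (A : {set 'I_n}) : #|A| == a -> #|(~: A)%SET| = (n - a)%N.
  move=> /eqP <-; have := cardsC A; rewrite card_ord => H.
  by rewrite -[X in (X - _)%N]H addKn.
have -> : dTV (transcript_law (law_H1 q (Kbip a b) (n := n)) (Q := Q))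
   (transcript_law (@law_H0 R q n) (Q := Q)) =
   dTV (transcript_law P' (Q := Q)) (transcript_law (@law_H0 R q n) (Q := Q)).
  congr (_ * _); apply: eq_bigr => t _; congr (`| _ - _ |).
  transitivity (\sum_(z in part_pairs n a b) (#|part_pairs n a b|%:R)^-1 *
      transcript_law (law_planted q (bip z.1 z.2)) t).
    rewrite /transcript_law; under eq_bigr do rewrite law_H1_Kbip //.
    by rewrite exchange_big /=; apply: eq_bigr => z _; rewrite mulr_sumr.
  under eq_bigr do rewrite transcript_law_planted.
  rewrite (@sum_part_pairs _ n a b (fun A B => (#|part_pairs n a b|%:R)^-1 *
      transcript_law (law_planted q (bip A B :&: Q)%SET) t)).
  rewrite [RHS]exchange_big /=; apply: eq_bigr => A cA.
  rewrite -[RHS]mulr_sumr [X in _ = _ * X]exchange_big /= [RHS]mulr_sumr.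
  apply: eq_bigr => B _; rewrite -[X in _ = _ * X]mulr_sumr [RHS]mulrA.
  by rewrite -invfM -natrM card_part_pairs cardC.
apply: le_trans (dTV_transcript_le _ _ _) _.
have w0 : 0 <= w by rewrite invr_ge0.
have wC : 'C(n, a)%:R * w = 1 by rewrite divff // pnatr_eq0 -lt0n bin_gt0.
have wsum : \sum_(A : {set 'I_n} | #|A| == a) w = 1.
  rewrite sumr_const (eq_card (B := [set A : {set 'I_n} | #|A| == a]%SET)).
    by rewrite card_draws card_ord -[LHS]mulr_natl.
  by move=> A; rewrite [RHS]inE.
apply: le_trans (dTV_mixture_le _ _ (fun A _ => w0) wsum) _.
pose beta : R := b%:R / (n - a)%:R.
pose deg u := (\sum_v inc Q u v)%N.
apply: (@le_trans _ _ (\sum_(A : {set 'I_n} | #|A| == a)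
    w * (delta + 2 / delta * (beta ^+ 2 * q^-1 ^+ a0 * (\sum_(u in A) (deg u)%:R))))).
  apply: ler_sum => A cA; rewrite ler_wpM2l //.
  rewrite -natr_sum /beta -(cardC A cA); apply: dTV_given_center_le => //.
    by rewrite (eqP cA).
  by rewrite (cardC A cA).
have -> : \sum_(A : {set 'I_n} | #|A| == a)
    w * (delta + 2 / delta * (beta ^+ 2 * q^-1 ^+ a0 * (\sum_(u in A) (deg u)%:R))) =
  delta + w * (2 / delta * (beta ^+ 2 * q^-1 ^+ a0)) *
    \sum_(A : {set 'I_n} | #|A| == a) \sum_(u in A) (deg u)%:R.
  rewrite -[X in X + _]mul1r -wsum mulr_suml mulr_sumr -big_split /=.
  by apply: eq_bigr => A _; rewrite mulrDr !mulrA.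
rewrite lerD2l.
have n0 : 0 < n%:R :> R by rewrite ltr0n.
have p0 : 0 <= q^-1 ^+ a0 by rewrite exprn_ge0 ?(le_trans ler01).
have sd : \sum_(A : {set 'I_n} | #|A| == a) \sum_(u in A) (deg u)%:R <=
    'C(n, a)%:R * (a0%:R / n%:R) * (2 * #|Q|%:R) :> R.
  have aI : (a <= #|'I_n|)%N by rewrite card_ord.
  have := @sum_draws_sum_le R _ a (fun u => (deg u)%:R) (fun u => ler0n _ _) aI.
  move=> /le_trans; apply; rewrite card_ord.
  apply: ler_pM; rewrite ?mulr_ge0 ?sumr_ge0 ?invr_ge0 ?ler0n //.
    by rewrite ler_wpM2l // ler_wpM2r ?invr_ge0 ?ler0n // ler_nat.
  by rewrite -natr_sum -natrM ler_nat sum_inc.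
have bb : beta ^+ 2 <= 4 * (b%:R ^+ 2 / n%:R ^+ 2).
  have -> : 4 * (b%:R ^+ 2 / n%:R ^+ 2) = (2 * b%:R / n%:R) ^+ 2 :> R.
    by field; rewrite gt_eqF.
  have na0 : 0 < (n - a)%:R :> R by rewrite ltr0n (leq_trans bpos).
  rewrite ler_sqr ?nnegrE ?divr_ge0 ?mulr_ge0 ?ler0n //.
  by rewrite /beta ler_pdivrMr // mulrAC ler_pdivlMr // -!natrM ler_nat.
have k0 : 0 <= w * (2 / delta * q^-1 ^+ a0) by rewrite !mulr_ge0 // invr_ge0 ltW.
apply: (@le_trans _ _ (w * (2 / delta * (4 * (b%:R ^+ 2 / n%:R ^+ 2) * q^-1 ^+ a0)) *
   ('C(n, a)%:R * (a0%:R / n%:R) * (2 * #|Q|%:R)))).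
  apply: ler_pM => //.
  - by rewrite !mulr_ge0 ?sqr_ge0 // invr_ge0 ltW.
  - by rewrite !sumr_ge0 // => A _; rewrite sumr_ge0.
  - by rewrite !ler_wpM2l ?ler_wpM2r // divr_ge0 // ltW.
rewrite le_eqVlt; apply/orP; left; apply/eqP.
transitivity (('C(n, a)%:R * w) * (16 * a0%:R * q^-1 ^+ a0 / delta *
  (b%:R ^+ 2 / n%:R ^+ 3) * #|Q|%:R)); last by rewrite wC mul1r.
by field; rewrite !gt_eqF.
Qed.
End impossibility.

(** * Detection *)

(** Reads a transcript as a graph in which unqueried pairs are absent, so that tests can be written
    on graphs. *)
Definition observed (n : nat) (Q : {set vpair n}) (t : transcript_type Q) :
    graph n := [set e | if insub e is Some e' then t e' else false]%SET.

Lemma observed_transcript (n : nat) (Q : {set vpair n}) (G : graph n) :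
  observed (transcript Q G) = (G :&: Q)%SET.
Proof.
apply/finset.setP => e; rewrite !inE; case: insubP => [e' eQ <-|/negbTE ->].
  by rewrite ffunE (valP e') andbT.
by rewrite andbF.
Qed.

Section detection.
Context (R : realType) (q : R) (hq : 0 < q < 1).

Definition excess (n : nat) (E : {set vpair n}) (G : graph n) : R :=
  \sum_(e in E) ((e \in G)%:R - q).

(** A planted pair contributes exactly [expR (l * (1 - q))]. For an unplanted pair the linear terms
    cancel, and the quadratic bound leaves at most [1 + 2 * q * (1 - q) * l ^+ 2], below
    [expR (l ^+ 2)]. *)
Lemma planted_mgf_le (n : nat) (S E : {set vpair n}) (l : R) : `|l| <= 2^-1 ->
  \sum_(G : graph n) law_planted q S G * expR (l * excess E G) <=
  expR (l * (1 - q) * #|(E :&: S)%SET|%:R + l ^+ 2 * #|E|%:R).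
Proof.
move=> hl.
pose g e (b : bool) := (if e \in S then b%:R else edge_law q b) *
  (if e \in E then expR (l * (b%:R - q)) else 1).
have -> : \sum_(G : graph n) law_planted q S G * expR (l * excess E G) =
    \sum_(G : graph n) \prod_e g e (e \in G).
  apply: eq_bigr => G _; rewrite big_split /=; congr (_ * _).
  by rewrite -big_mkcond /= /excess mulr_sumr expR_sum.
rewrite sum_graphs_prod.
have -> : l * (1 - q) * #|(E :&: S)%SET|%:R + l ^+ 2 * #|E|%:R =
   \sum_(e in E) (l * (1 - q) * (e \in S)%:R + l ^+ 2).
  rewrite big_split /= -mulr_sumr sumr_const -[X in _ = _ + X]mulr_natr.
  congr (_ * _ + _).
  rewrite -natr_sum -big_mkcondr /= sum1_card; congr _%:R.
  by apply: eq_card => e; rewrite inE.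
rewrite expR_sum [leRHS]big_mkcond /=; apply: ler_prod => e _.
have /andP[q0 q1] := hq.
have [l1 l2] : - 2^-1 <= l /\ l <= 2^-1 by move: hl; rewrite ler_norml => /andP.
rewrite /g /edge_law; case: (e \in S); case: (e \in E) => /=.
- rewrite mul0r addr0 mul1r expR_ge0 mulr1 ler_expR lerDl sqr_ge0 //.
- by rewrite mul0r addr0 mul1r ler01 lexx.
- apply/andP; split.
    by rewrite addr_ge0 // mulr_ge0 ?expR_ge0 // ltW // subr_gt0.
  rewrite mulr0 [X in _ <= expR X]add0r; apply: le_trans (expR_ge1Dx _).
  have e1 : expR (l * (1 - q)) <= 1 + l * (1 - q) + 2 * (l * (1 - q)) ^+ 2.
    by apply: expR_le_quadratic; nra.
  have e0 : expR (l * (0 - q)) <= 1 + l * (0 - q) + 2 * (l * (0 - q)) ^+ 2.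
    by apply: expR_le_quadratic; nra.
  have h1 := ler_wpM2l (ltW q0) e1.
  have q1' : 0 <= 1 - q by lra.
  have h0 := ler_wpM2l q1' e0.
  apply: (le_trans (lerD h1 h0)); rewrite -subr_ge0.
  have -> : 1 + l ^+ 2 - (q * (1 + l * (1 - q) + 2 * (l * (1 - q)) ^+ 2) +
     (1 - q) * (1 + l * (0 - q) + 2 * (l * (0 - q)) ^+ 2)) =
     l ^+ 2 * (2^-1 + 2 * (q - 2^-1) ^+ 2) by field.
  by rewrite mulr_ge0 ?sqr_ge0 // addr_ge0 // mulr_ge0 // sqr_ge0.
- by rewrite !mulr1 subrKC ler01 lexx.
Qed.

Lemma null_upper_tail (n m : nat) (E : {set vpair n}) (t : R) :
  (0 < m)%N -> (#|E| <= m)%N -> 0 <= t <= m%:R ->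
  \sum_(G : graph n | t <= excess E G) law_H0 q G <= expR (- (t ^+ 2 / (4 * m%:R))).
Proof.
move=> m0 Em /andP[t0 tm]; have mR : 0 < m%:R :> R by rewrite ltr0n.
(* The minimiser of [- l * t + l ^+ 2 * m]; the bound [t <= m] keeps it at most [1/2]. *)
pose l := t / (2 * m%:R).
have l0 : 0 <= l by rewrite divr_ge0 // mulr_ge0 // ltW.
have hl : `|l| <= 2^-1.
  by rewrite ger0_norm // /l ler_pdivrMr ?mulr_gt0 //; lra.
apply: (@le_trans _ _ (expR (- (l * t)) *
   \sum_(G : graph n) law_planted q finset.set0 G * expR (l * excess E G))).
  rewrite mulr_sumr [leLHS]big_mkcond /=; apply: ler_sum => G _.
  have L0 := law_planted_ge0 hq finset.set0 G.
  case: ifP => tE; last by rewrite !mulr_ge0 ?expR_ge0.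
  rewrite law_H0E mulrCA -expRD -[leLHS]mulr1 ler_wpM2l //.
  rewrite -expR0 ler_expR addrC -mulrBr mulr_ge0 // subr_ge0 //.
apply: (@le_trans _ _ (expR (- (l * t)) * expR (l ^+ 2 * #|E|%:R))).
  rewrite ler_wpM2l ?expR_ge0 //.
  by have := planted_mgf_le finset.set0 E hl; rewrite finset.setI0 cards0 mulr0 add0r.
rewrite -expRD ler_expR.
have h : l ^+ 2 * #|E|%:R <= l ^+ 2 * m%:R by rewrite ler_wpM2l ?sqr_ge0 ?ler_nat.
have -> : - (t ^+ 2 / (4 * m%:R)) = - (l * t) + l ^+ 2 * m%:R.
  by rewrite /l; field; rewrite gt_eqF.
by rewrite lerD2l.
Qed.

(** The mean excess is [(1 - q) * #|E :&: S|], at least [2 * t]. Falling below [t] is thus a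
    deviation of at least [t], and the Chernoff parameter is the negative of the one for the upper
    tail. *)
Lemma planted_lower_tail (n m : nat) (S E : {set vpair n}) (t : R) :
  (0 < m)%N -> (#|E| <= m)%N -> 0 <= t <= m%:R ->
  2 * t <= (1 - q) * #|(E :&: S)%SET|%:R ->
  \sum_(G : graph n | excess E G < t) law_planted q S G <=
  expR (- (t ^+ 2 / (4 * m%:R))).
Proof.
move=> m0 Em /andP[t0 tm] tE; have mR : 0 < m%:R :> R by rewrite ltr0n.
pose l := t / (2 * m%:R).
have l0 : 0 <= l by rewrite divr_ge0 // mulr_ge0 // ltW.
have hl : `|- l| <= 2^-1.
  by rewrite normrN ger0_norm // /l ler_pdivrMr ?mulr_gt0 //; lra.
apply: (@le_trans _ _ (expR (l * t) *
   \sum_(G : graph n) law_planted q S G * expR (- l * excess E G))).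
  rewrite mulr_sumr [leLHS]big_mkcond /=; apply: ler_sum => G _.
  have L0 := law_planted_ge0 hq S G.
  case: ifP => tG; last by rewrite !mulr_ge0 ?expR_ge0.
  rewrite mulrCA -expRD -[leLHS]mulr1 ler_wpM2l //.
  by rewrite -expR0 ler_expR mulNr -mulrBr mulr_ge0 // subr_ge0 ltW.
apply: (@le_trans _ _ (expR (l * t) *
    expR (- l * (1 - q) * #|(E :&: S)%SET|%:R + (- l) ^+ 2 * #|E|%:R))).
  by rewrite ler_wpM2l ?expR_ge0 // planted_mgf_le.
rewrite -expRD ler_expR sqrrN.
have h : l ^+ 2 * #|E|%:R <= l ^+ 2 * m%:R by rewrite ler_wpM2l ?sqr_ge0 ?ler_nat.
have h2 : l * (2 * t) <= l * ((1 - q) * #|(E :&: S)%SET|%:R) by rewrite ler_wpM2l.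
have -> : - (t ^+ 2 / (4 * m%:R)) = l * t - l * (2 * t) + l ^+ 2 * m%:R.
  by rewrite /l; field; rewrite gt_eqF.
lra.
Qed.

Definition scan (n : nat) (S : {set 'I_n}) (t : R) (G : graph n) : bool :=
  [exists u, t <= excess (star S u) G].

Lemma scan_touching (n : nat) (S : {set 'I_n}) (t : R) (G : graph n) :
  scan S t (G :&: touching S)%SET = scan S t G.
Proof.
apply: eq_existsb => u; congr (_ <= _); apply: eq_bigr => e eu.
by rewrite inE (fintype.subsetP (star_touching S u)) ?andbT.
Qed.

(** Union bound over the [n] possible centres. *)
Lemma scan_type1 (n m : nat) (S : {set 'I_n}) (t : R) :
  (0 < m)%N -> (#|S| <= m)%N -> 0 <= t <= m%:R ->
  \sum_(G : graph n | scan S t G) law_H0 q G <=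
  n%:R * expR (- (t ^+ 2 / (4 * m%:R))).
Proof.
move=> m0 Sm ht.
apply: (@le_trans _ _ (\sum_(u < n) \sum_(G : graph n | t <= excess (star S u) G)
   law_H0 q G)).
  under [leRHS]eq_bigr do rewrite big_mkcond /=.
  rewrite exchange_big /= [leLHS]big_mkcond /=; apply: ler_sum => G _.
  have L0 := ltW (law_H0_gt0 hq G).
  case: ifP => [/existsP[u tu]|_]; last by apply: sumr_ge0 => u _; case: ifP.
  rewrite (bigD1 u) //= tu lerDl.
  by apply: sumr_ge0 => v _; case: ifP.
rewrite -[n in n%:R]card_ord mulr_natl -sumr_const; apply: ler_sum => u _.
by apply: null_upper_tail => //; exact: leq_trans (card_star S u) Sm.
Qed.

(** The threshold is a quarter of the expected planted shift [(1 - q) * mu]. If [#|B :&: S|] is at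
    least [mu / 2], one centre in [A] already passes except with Chernoff probability; the opposite
    event costs at most [4 / mu] by Chebyshev. *)
Lemma scan_type2 (n m a b : nat) (S : {set 'I_n}) (t : R) :
  (0 < m)%N -> #|S| = m -> (0 < a)%N -> (0 < b)%N -> (a + b <= n)%N ->
  t = (1 - q) / 4 * (m%:R * b%:R / n%:R) ->
  \sum_(G : graph n | ~~ scan S t G) law_H1 q (Kbip a b) G <=
  expR (- (t ^+ 2 / (4 * m%:R))) + 4 * (m%:R * b%:R / n%:R)^-1.
Proof.
move=> m0 Sm a0 b0 abn; have /andP[q0 q1] := hq.
have an : (a <= n)%N := leq_trans (leq_addr _ _) abn.
have bn : (b <= n)%N := leq_trans (leq_addl _ _) abn.
have bna : (b <= n - a)%N by rewrite leq_subRL.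
have anb : (a <= n - b)%N by rewrite leq_subRL // addnC.
set mu : R := m%:R * b%:R / n%:R => tE.
have n0 : 0 < n%:R :> R by rewrite ltr0n (leq_trans a0).
have mR : 0 < m%:R :> R by rewrite ltr0n.
have mu0 : 0 < mu by rewrite divr_gt0 ?mulr_gt0 // ltr0n.
have mum : mu <= m%:R.
  by rewrite /mu ler_pdivrMr // ler_wpM2l // ler_nat.
have t0 : 0 <= t by rewrite tE mulr_ge0 ?divr_ge0 //; lra.
have tm : t <= m%:R.
  apply: le_trans mum; rewrite tE -[leRHS]mul1r ler_wpM2r ?(ltW mu0) //; lra.
set X := part_pairs n a b.
set ex := expR _; have ex0 : 0 <= ex by exact: expR_ge0.
have X0 : 0 < #|X|%:R :> R.
  by rewrite ltr0n card_part_pairs muln_gt0 !bin_gt0 an.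
under eq_bigr do rewrite law_H1_Kbip //.
rewrite exchange_big /= -/X.
(* Chebyshev applied pointwise: when [#|B :&: S| < mu / 2], the second summand is at least 1 and
   dominates any probability. *)
apply: (@le_trans _ _ (\sum_(z in X) #|X|%:R^-1 *
    (ex + (mu / 2) ^- 2 * (#|(z.2 :&: S)%SET|%:R - mu) ^+ 2))).
  apply: ler_sum => -[A B]; rewrite inE /= => /and3P[/eqP cA /eqP cB dAB].
  rewrite -mulr_sumr ler_wpM2l ?invr_ge0 ?ler0n //.
  set k := #|(B :&: S)%SET|%:R.
  have [kmu|muk] := ltP k (mu / 2).
    apply: (@le_trans _ _ 1).
      rewrite -(law_planted_sum1 q (bip A B)).
      rewrite [leRHS](bigID (fun G => ~~ scan S t G)) /=.
      by rewrite lerDl sumr_ge0 // => G _; exact: law_planted_ge0.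
    have mu2 : 0 < (mu / 2) ^+ 2 by rewrite exprn_gt0 // divr_gt0.
    rewrite ler_wpDl // [leRHS]mulrC ler_pdivlMr // mul1r.
    rewrite -[leRHS]sqrrN ler_sqr ?nnegrE; lra.
  have [u uA] : exists u, u \in A by apply/finset.set0Pn; rewrite -card_gt0 cA.
  apply: (@le_trans _ _ ex); last first.
    by rewrite lerDl mulr_ge0 ?invr_ge0 ?sqr_ge0.
  apply: le_trans (@planted_lower_tail n m (bip A B) (star S u) t m0 _ _ _).
  - rewrite [leLHS]big_mkcond [leRHS]big_mkcond; apply: ler_sum => G _.
    case: ifP => [/existsPn/(_ u)|_]; first by rewrite -ltNge => ->.
    by case: ifP => _; rewrite ?law_planted_ge0.
  - by rewrite -Sm card_star.
  - by rewrite t0 tm.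
  apply: (@le_trans _ _ ((1 - q) * k)).
    rewrite [leLHS](_ : _ = (1 - q) * (mu / 2)); last by rewrite tE; field.
    by rewrite ler_wpM2l //; lra.
  rewrite ler_wpM2l ?ler_nat ?card_star_bip //; lra.
rewrite -mulr_sumr big_split /= sumr_const -mulr_sumr.
have -> : #|X|%:R^-1 * (ex *+ #|X| + (mu / 2) ^- 2 *
     \sum_(z in X) (#|(z.2 :&: S)%SET|%:R - mu) ^+ 2) =
  ex + (mu / 2) ^- 2 * (#|X|%:R^-1 *
     \sum_(z in X) (#|(z.2 :&: S)%SET|%:R - mu) ^+ 2).
  by rewrite -mulr_natr; field; rewrite !gt_eqF.
rewrite lerD2l.
(* Only [B] enters the summand; drawing it first leaves a uniform [b]-subset and a constant sum over
   [A]. *)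
rewrite (@sum_part_pairs_swap _ n a b (fun A B => (#|(B :&: S)%SET|%:R - mu) ^+ 2)).
rewrite (@sum_part_pairs _ n b a (fun B A => (#|(B :&: S)%SET|%:R - mu) ^+ 2)).
have cX : #|X| = ('C(n, b) * 'C(n - b, a))%N.
  rewrite -card_part_pairs -!sum1_card.
  exact: (@sum_part_pairs_swap nat n a b (fun _ _ => 1%N)).
have inner (B : {set 'I_n}) : #|B| == b ->
    \sum_(A : {set 'I_n} | (A \subset ~: B)%SET && (#|A| == a))
      (#|(B :&: S)%SET|%:R - mu) ^+ 2 =
    'C(n - b, a)%:R * (#|(B :&: S)%SET|%:R - mu) ^+ 2.
  move=> /eqP cB; rewrite sumr_const mulr_natl; congr (_ *+ _).
  have -> : (n - b)%N = #|(~: B)%SET|.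
    by have := cardsC B; rewrite card_ord cB => H; rewrite -[X in (X - _)%N]H addKn.
  by rewrite -cards_draws; apply: eq_card => A; rewrite [RHS]inE.
rewrite (eq_bigr _ inner) -mulr_sumr.
have c1 : 0 < 'C(n, b)%:R :> R by rewrite ltr0n bin_gt0.
have c2 : 0 < 'C(n - b, a)%:R :> R by rewrite ltr0n bin_gt0.
have bI : (b <= #|'I_n|)%N by rewrite card_ord.
have := @sum_draws_variance_le R _ b S b0 bI.
rewrite Sm card_ord -/mu => hvar.
rewrite cX natrM -/mu.
set V := \sum_(i | _) _ in hvar *.
have -> : ('C(n, b)%:R * 'C(n - b, a)%:R)^-1 * ('C(n - b, a)%:R * V) =
    'C(n, b)%:R^-1 * V by field; rewrite !gt_eqF.
apply: (@le_trans _ _ ((mu / 2) ^- 2 * mu)).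
  by rewrite ler_wpM2l ?invr_ge0 ?sqr_ge0 // ler_pdivrMl.
by rewrite le_eqVlt; apply/orP; left; apply/eqP; field; rewrite gt_eqF.
Qed.
End detection.

(** * Risk and error bounds at fixed size *)

Section asymptotics.
Context (R : realType) (q : R) (hq : 0 < q < 1).

Lemma optimal_risk_near1 (Gamma : sgraph) (n k : nat) (B : R) :
  (forall Q : {set vpair n}, (#|Q| <= k)%N ->
     dTV (transcript_law (law_H1 q Gamma (n := n)) (Q := Q))
         (transcript_law (@law_H0 R q n) (Q := Q)) <= B) ->
  `|1 - optimal_risk q Gamma n k| <= B.
Proof.
move=> hB; rewrite /optimal_risk opprB addrCA subrr addr0.
set E := image _ _.
(* The empty query set is within every budget, so the supremum is over a nonempty set. *)
have E0 : E (dTV (transcript_law (law_H1 q Gamma (n := n)) (Q := finset.set0))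
                 (transcript_law (@law_H0 R q n) (Q := finset.set0))).
  by exists finset.set0 => //=; rewrite cards0.
have Eub : ubound E B by move=> _ [Q /= Qk <-]; exact: hB.
rewrite ger0_norm; first by apply: ge_sup => //; eexists; exact: E0.
by apply: (le_trans (dTV_ge0 _ _)); apply: ub_le_sup E0; exists B.
Qed.

Lemma error_sum_nonrandom (Gamma : sgraph) (n : nat) (Q0 : {set vpair n})
    (phi : forall Q : {set vpair n}, transcript_type Q -> bool) :
  error_sum q Gamma (fun Q => (Q == Q0)%:R) phi =
  \sum_(G : graph n | phi Q0 (transcript Q0 G)) law_H0 q G +
  \sum_(G : graph n | ~~ phi Q0 (transcript Q0 G)) law_H1 q Gamma G.
Proof.
have pick (P : graph n -> R) (psi : forall Q, pred (transcript_type Q)) :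
    \sum_(Q : {set vpair n}) (Q == Q0)%:R *
      \sum_(t : transcript_type Q | psi Q t) transcript_law P t =
    \sum_(G : graph n | psi Q0 (transcript Q0 G)) P G.
  rewrite (bigD1 Q0) //= eqxx mul1r sum_transcript_law [X in _ + X]big1 ?addr0 //.
  by move=> Q /negbTE ->; rewrite mul0r.
by rewrite /error_sum (pick _ phi) (pick _ (fun Q t => ~~ phi Q t)).
Qed.

(** The exponent equals [(1 - q) ^+ 2 / 64 * (b / n) ^+ 2 * m], so the constant 128 makes it at
    least [2 * ln n]. The union bound then leaves [1 / n], and [mu >= ln n] controls the Chebyshev
    term; the total [6 / ln n] is 1 for type I and 1 + 4 for type II. *)
Lemma scan_error_le (n m a b : nat) (S : {set 'I_n}) (t : R) :
  (0 < m)%N -> #|S| = m -> (0 < a)%N -> (a <= b)%N -> (a + b <= n)%N ->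
  1 <= ln (n%:R : R) ->
  128 / (1 - q) ^+ 2 * (n%:R ^+ 2 / b%:R ^+ 2) * ln n%:R <= m%:R ->
  t = (1 - q) / 4 * (m%:R * b%:R / n%:R) ->
  \sum_(G : graph n | scan q S t G) law_H0 q G +
  \sum_(G : graph n | ~~ scan q S t G) law_H1 q (Kbip a b) G <= 6 / ln n%:R.
Proof.
move=> m0 Sm a0 ab abn; set L := ln n%:R => L1 hm tE.
have b0 : (0 < b)%N := leq_trans a0 ab.
have bn' : (b <= n)%N := leq_trans (leq_addl _ _) abn.
have /andP[q0 q1] := hq.
have n0 : 0 < n%:R :> R by rewrite ltr0n (leq_trans b0).
have bR : 0 < b%:R :> R by rewrite ltr0n.
have mR : 0 < m%:R :> R by rewrite ltr0n.
have bn : b%:R <= n%:R :> R by rewrite ler_nat.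
have Ln : L <= n%:R by apply/ltW/ln_sublinear.
set mu := m%:R * b%:R / n%:R in tE.
have mum : mu <= m%:R by rewrite /mu ler_pdivrMr // ler_wpM2l // ltW.
have mu0 : 0 < mu by rewrite divr_gt0 ?mulr_gt0.
have t0 : 0 <= t by rewrite tE mulr_ge0 ?(ltW mu0) ?divr_ge0 //; lra.
have tm : t <= m%:R.
  apply: le_trans mum; rewrite tE -[leRHS]mul1r ler_wpM2r ?(ltW mu0) //; lra.
have k0 : 0 < (1 - q) ^+ 2 by rewrite exprn_gt0 // subr_gt0.
have expo : 2 * L <= t ^+ 2 / (4 * m%:R).
  have -> : t ^+ 2 / (4 * m%:R) = (1 - q) ^+ 2 / 64 * (b%:R ^+ 2 / n%:R ^+ 2) * m%:R.
    by rewrite tE /mu; field; rewrite !gt_eqF.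
  have c0 : 0 <= (1 - q) ^+ 2 / 64 * (b%:R ^+ 2 / n%:R ^+ 2).
    by rewrite mulr_ge0 ?divr_ge0 ?sqr_ge0.
  apply: le_trans (ler_wpM2l c0 hm); rewrite le_eqVlt; apply/orP; left; apply/eqP.
  by field; rewrite !gt_eqF // subr_gt0.
have muL : L <= mu.
  have kL : 128 / (1 - q) ^+ 2 >= 1.
    rewrite ler_pdivlMr // mul1r expr2; nra.
  have bnz : 0 <= b%:R / n%:R :> R by rewrite divr_ge0.
  have muE : mu = m%:R * (b%:R / n%:R) by rewrite /mu mulrA.
  rewrite muE; apply: le_trans (ler_wpM2r bnz hm).
  have -> : 128 / (1 - q) ^+ 2 * (n%:R ^+ 2 / b%:R ^+ 2) * L * (b%:R / n%:R) =
     128 / (1 - q) ^+ 2 * ((n%:R / b%:R) * L).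
    by field; rewrite !gt_eqF // subr_gt0.
  have nb1 : 1 <= n%:R / b%:R :> R by rewrite ler_pdivlMr // mul1r.
  have nbL : L <= n%:R / b%:R * L by rewrite ler_peMl //; lra.
  apply: (le_trans nbL); rewrite ler_peMl //; lra.
have ex : expR (- (t ^+ 2 / (4 * m%:R))) <= n%:R ^- 2.
  apply: (@le_trans _ _ (expR (- (2 * L)))); first by rewrite ler_expR lerN2.
  by rewrite mulr_natl mulr2n expRN expRD /L lnK ?posrE // -expr2.
have Lpos : 0 < L by lra.
have n1 : 1 <= n%:R :> R by lra.
have ex1 : n%:R * expR (- (t ^+ 2 / (4 * m%:R))) <= L^-1.
  apply: (@le_trans _ _ (n%:R * n%:R ^- 2)); first by rewrite ler_wpM2l ?(ltW n0).
  have -> : n%:R * n%:R ^- 2 = n%:R^-1 :> R by field; rewrite gt_eqF.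
  by rewrite lef_pV2 ?posrE.
have ex2 : expR (- (t ^+ 2 / (4 * m%:R))) <= L^-1.
  apply: le_trans ex1; rewrite ler_peMl ?expR_ge0 //.
have muL' : mu^-1 <= L^-1 by rewrite lef_pV2 ?posrE.
have e1 := @scan_type1 _ _ hq n m S t m0 (eq_leq Sm).
have {}e1 := e1 _; rewrite t0 tm in e1; have {}e1 := e1 isT.
have e2 := @scan_type2 _ _ hq n m a b S t m0 Sm a0 b0 abn tE.
rewrite -/mu in e2.
lra.
Qed.
End asymptotics.

(** * Limits along sequences of graphs *)

Local Open Scope classical_set_scope.
Local Open Scope ring_scope.

Lemma law_H1_ge0 (R : realType) (q : R) (hq : 0 < q < 1) (Gamma : sgraph)
    (n : nat) (G : graph n) : 0 <= law_H1 q Gamma G.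
Proof.
rewrite mulr_ge0 ?invr_ge0 // sumr_ge0 // => H _; exact: law_planted_ge0.
Qed.

Lemma weak_detection_impossible_Kbip (R : realType) (q : R) (hq : 0 < q < 1)
    (a0 : nat) (a b Qn : nat -> nat) :
  (\forall n \near \oo,
     [/\ (1 <= a n)%N, (a n <= b n)%N, (a n + b n <= n)%N & (a n <= a0)%N]) ->
  (fun n => (Qn n)%:R : R^o) =o_\oo
    (fun n => n%:R ^+ 3 / (b n)%:R ^+ 2 : R^o) ->
  weak_detection_impossible q (fun n => Kbip (a n) (b n)) Qn.
Proof.
move=> hab /eqoP ho; apply/cvgrPdist_le => eps eps0.
(* Half of [eps] goes to [delta], the other half to the budget term; the added 1 in [K] below keeps
   it positive when [a0 = 0]. *)
pose delta : R := Num.min 1 (eps / 2).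
have d0 : 0 < delta by rewrite lt_min ltr01 divr_gt0.
have d1 : delta <= 1 by rewrite ge_min lexx.
have de : delta <= eps / 2 by rewrite ge_min lexx orbT.
have q0 : 0 < q by case/andP: hq.
pose K : R := 16 * a0%:R * q^-1 ^+ a0 / delta + 1.
have K0 : 0 < K.
  by rewrite ltr_wpDl // !mulr_ge0 ?exprn_ge0 ?invr_ge0 // ltW.
have e'0 : 0 < eps / 2 / K by rewrite !divr_gt0.
have := ho _ e'0; apply: filterS2 hab => n [a1 ab abn aa0] hQ.
apply: optimal_risk_near1 => Q hQk.
have hd : 0 < delta <= 1 by rewrite d0.
apply: le_trans (dTV_le_budget hq Q hd a1 ab abn aa0) _.
have bpos : (0 < b n)%N := leq_trans a1 ab.
have bn : (b n <= n)%N := leq_trans (leq_addl _ _) abn.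
have n0 : 0 < n%:R :> R by rewrite ltr0n (leq_trans bpos).
have b0 : 0 < (b n)%:R :> R by rewrite ltr0n.
have {}hQ : #|Q|%:R <= eps / 2 / K * (n%:R ^+ 3 / (b n)%:R ^+ 2).
  apply: (@le_trans _ _ (Qn n)%:R); first by rewrite ler_nat.
  move: hQ; rewrite /= ger0_norm // ger0_norm // divr_ge0 ?exprn_ge0 //.
rewrite [eps]splitr lerD //.
have nb0 : 0 <= (b n)%:R ^+ 2 / n%:R ^+ 3 :> R by rewrite divr_ge0 ?exprn_ge0.
apply: (@le_trans _ _ (K * ((b n)%:R ^+ 2 / n%:R ^+ 3) * #|Q|%:R)).
  by rewrite !ler_wpM2r // /K lerDl.
apply: (@le_trans _ _ (K * ((b n)%:R ^+ 2 / n%:R ^+ 3) *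
  (eps / 2 / K * (n%:R ^+ 3 / (b n)%:R ^+ 2)))).
  by rewrite ler_wpM2l // mulr_ge0 // ltW.
rewrite le_eqVlt; apply/orP; left; apply/eqP; field.
by rewrite !gt_eqF.
Qed.

(** The scan queries at most [m * n] pairs. The factor 2 in the budget absorbs the rounding in [m],
    and one of the two logarithms is slack. *)
Lemma strong_detection_possible_Kbip (R : realType) (q : R) (hq : 0 < q < 1)
    (a b Qn : nat -> nat) :
  let C1 := 128 / (1 - q) ^+ 2 in
  let m n : int := Num.ceil (C1 * (n%:R ^+ 2 / (b n)%:R ^+ 2) * ln n%:R) in
  (\forall n \near \oo, [/\ (1 <= a n)%N, (a n <= b n)%N & (a n + b n <= n)%N]) ->
  (\forall n \near \oo, (m n)%:~R <= n%:R / 2 :> R) ->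
  (\forall n \near \oo,
     (Qn n)%:R >= 2 * C1 * (n%:R ^+ 3 / (b n)%:R ^+ 2) * ln n%:R ^+ 2) ->
  strong_detection_possible q (fun n => Kbip (a n) (b n)) Qn.
Proof.
move=> C1 m hab hm hQ; have /andP[q0 q1] := hq.
pose M n := `|m n|%N.
pose S n : {set 'I_n} := [set i : 'I_n | (i < M n)%N]%SET.
(* The budget must hold for every [n] but is assumed large only eventually, hence the empty
   fallback. *)
pose Q n := if (#|touching (S n)| <= Qn n)%N then touching (S n) else finset.set0.
pose t n : R := (1 - q) / 4 * ((M n)%:R * (b n)%:R / n%:R).
exists (fun n Q' => (Q' == Q n)%:R).
exists (fun n Q' tr => scan q (S n) (t n) (observed tr)).
split=> [n|n Q'|].
- split=> [Q'|]; first exact: ler0n.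
  by rewrite (bigD1 (Q n)) //= eqxx big1 ?addr0 // => Q' /negbTE ->.
- case: eqP => [-> _|_]; last by rewrite ltxx.
  by rewrite /Q; case: ifP => //; rewrite cards0.
apply/cvgrPdist_le => eps eps0.
near=> n.
have [a1 ab abn] : [/\ (1 <= a n)%N, (a n <= b n)%N & (a n + b n <= n)%N].
  by near: n.
have mn2 : (m n)%:~R <= n%:R / 2 :> R by near: n.
have Qnn : (Qn n)%:R >= 2 * C1 * (n%:R ^+ 3 / (b n)%:R ^+ 2) * ln n%:R ^+ 2.
  by near: n.
(* Makes [ln n] at least 1 and [6 / ln n] at most [eps]. *)
have big : expR (1 + 6 / eps) <= n%:R by near: n; exact: nbhs_infty_ger.
have bpos : (0 < b n)%N := leq_trans a1 ab.
have bn : (b n <= n)%N := leq_trans (leq_addl _ _) abn.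
have n0 : 0 < n%:R :> R by rewrite ltr0n (leq_trans bpos).
have b0 : 0 < (b n)%:R :> R by rewrite ltr0n.
have L1 : 1 + 6 / eps <= ln n%:R.
  by rewrite -[leLHS]expRK ler_ln ?posrE ?expR_gt0.
set L := ln n%:R in Qnn L1 *.
have e6 : 0 < 6 / eps by rewrite divr_gt0.
have Lge1 : 1 <= L by lra.
have C1ge1 : 1 <= C1.
  by rewrite /C1 ler_pdivlMr ?exprn_gt0 ?subr_gt0 // mul1r expr2; nra.
pose x : R := n%:R ^+ 2 / (b n)%:R ^+ 2.
have x1 : 1 <= x.
  by rewrite ler_pdivlMr ?exprn_gt0 // mul1r ler_sqr ?nnegrE // ler_nat.
have xL : 1 <= C1 * x * L.
  exact: (mulr_ege1 (mulr_ege1 C1ge1 x1) Lge1).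
have mE : (m n)%:~R = (M n)%:R :> R.
  rewrite /M natr_absz ger0_norm // ceil_ge0; apply: lt_le_trans xL; lra.
have Mge : C1 * x * L <= (M n)%:R by rewrite -mE; exact: ceil_ge.
have Mle : (M n)%:R <= C1 * x * L + 1.
  rewrite -mE -lerBlDr; apply/ltW; have := ceilB1_lt (C1 * x * L).
  by rewrite intrB.
have M0 : (0 < M n)%N by rewrite -(ltr0n R); lra.
(* Ensures that the initial segment [S n] has exactly [M n] vertices. *)
have Mn : (M n <= n)%N.
  by rewrite -(ler_nat R) -mE; lra.
have cS : #|S n| = M n.
  rewrite -sum1dep_card (eq_bigl (fun i : 'I_n => (i < M n)%N)) // big_ord_narrow //.
  by rewrite sum1_card card_ord.
have QE : Q n = touching (S n).
  rewrite /Q ifT // -(ler_nat R); apply: le_trans Qnn.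
  apply: (@le_trans _ _ ((M n)%:R * n%:R)).
    by rewrite -natrM ler_nat -cS card_touching.
  have -> : 2 * C1 * (n%:R ^+ 3 / (b n)%:R ^+ 2) * L ^+ 2 =
     2 * (C1 * x * L) * L * n%:R by rewrite /x; field; rewrite gt_eqF.
  rewrite ler_wpM2r // ?(ltW n0) //; nra.
rewrite error_sum_nonrandom sub0r normrN.
rewrite ger0_norm; last first.
  by rewrite addr_ge0 // sumr_ge0 // => G _;
    [exact/ltW/law_H0_gt0|exact: law_H1_ge0].
under eq_bigl do rewrite observed_transcript QE scan_touching.
under [X in _ + X]eq_bigl do rewrite observed_transcript QE scan_touching.
have E := @scan_error_le R q hq n (M n) (a n) (b n) (S n) (t n) M0 cS a1 ab abn
  Lge1 Mge erefl.
rewrite -/L in E; apply: (le_trans E); rewrite ler_pdivrMr; last lra.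
rewrite mulrC -ler_pdivrMr //; lra.
Unshelve. all: by end_near.
Qed.

Theorem corollary10 (R : realType) (q : R) (hq : 0 < q < 1) :
  (forall (a0 : nat) (a b Qn : nat -> nat),
     (\forall n \near \oo,
        [/\ (1 <= a n)%N, (a n <= b n)%N, (a n + b n <= n)%N
          & (a n <= a0)%N]) ->
     (fun n => (Qn n)%:R : R^o) =o_\oo
       (fun n => n%:R ^+ 3 / (b n)%:R ^+ 2 : R^o) ->
     weak_detection_impossible q (fun n => Kbip (a n) (b n)) Qn) /\
  (exists2 C1 : R, 0 < C1 & forall a0 : nat, exists2 C : R, 0 < C &
     forall a b Qn : nat -> nat,
     let m n : int := Num.ceil (C1 * (n%:R ^+ 2 / (b n)%:R ^+ 2) * ln n%:R) in
     (\forall n \near \oo,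
        [/\ (1 <= a n)%N, (a n <= b n)%N, (a n + b n <= n)%N
          & (a n <= a0)%N]) ->
     (\forall n \near \oo, (m n)%:~R <= n%:R / 2 :> R) ->
     (\forall n \near \oo,
        (a n + b n)%:R * (m n)%:~R / n%:R >= 10 * ln n%:R :> R) ->
     (\forall n \near \oo,
        (Qn n)%:R >= C * (n%:R ^+ 3 / (b n)%:R ^+ 2) * ln n%:R ^+ 2) ->
     strong_detection_possible q (fun n => Kbip (a n) (b n)) Qn).
Proof.
split=> [a0 a b Qn|]; first exact: weak_detection_impossible_Kbip.
have C10 : 0 < 128 / (1 - q) ^+ 2.
  by rewrite divr_gt0 // exprn_gt0 // subr_gt0; case/andP: hq.
exists (128 / (1 - q) ^+ 2) => // a0.
exists (2 * (128 / (1 - q) ^+ 2)); first by rewrite mulr_gt0.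
move=> a b Qn m hab hm _; apply: strong_detection_possible_Kbip => //.
by apply: filterS hab => n [].
Qed.
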